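(* Let $H\in(0,1)$, $\sigma>0$, $\tau\ge0$, and for $\lambda<\lambda^*$ let $(x_t)_{t\ge0}$ be a solution of the scalar equation $$\mathrm{d}x_t=A(\lambda)\,x_t\,\mathrm{d}t+\sigma\,\mathrm{d}W^H_t .$$ Then the time-asymptotic autocorrelation satisfies, in the limit $\lambda\to\lambda^*$, $$AC_\infty(\tau)=1-|A(\lambda)|^{2H}\frac{\tau^{2H}}{\Gamma(2H+1)}+\mathcal{O}\big(|A(\lambda)|^2\big).$$
   Context: $A:(-\infty,\lambda^*]\to\mathbb{R}$ is continuous with $A(\lambda)<0$ for $\lambda<\lambda^*$ and $A(\lambda^* )=0$. $(W^H_t)_{t\ge0}$ is a scalar fractional Brownian motion with Hurst index $H$: a centered Gaussian process with $\mathbb{E}[W^H_tW^H_s]=\tfrac12(t^{2H}+s^{2H}-|t-s|^{2H})$. Solutions satisfy $x_t=x_0+A(\lambda)\int_0^tx_s\,\mathrm{d}s+\sigma W^H_t$, with deterministic initial condition $x_0\in\mathbb{R}$. Put $V_t(\tau)=\mathbb{E}[x_tx_{t+\tau}]-\mathbb{E}[x_t]\mathbb{E}[x_{t+\tau}]$, $V_\infty(\tau)=\lim_{t\to\infty}V_t(\tau)$ and $AC_\infty(\tau)=V_\infty(\tau)/V_\infty(0)$ (all depending on $\lambda$). $\Gamma$ is Euler's gamma function. $b_1(\lambda)=\mathcal{O}(b_2(\lambda))$ means $\lim_{\lambda\to\lambda^*}|b_1(\lambda)/b_2(\lambda)|\in[0,\infty)$, with $\lambda\to\lambda^*$ from below.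 *)

(* Defs.v *)
From HB Require Import structures.
From mathcomp Require Import all_boot all_order all_algebra.
From mathcomp Require Import all_classical all_reals all_analysis.

Set Implicit Arguments.
Unset Strict Implicit.
Unset Printing Implicit Defensive.

Import Order.TTheory GRing.Theory Num.Theory.
Import numFieldNormedType.Exports.

Local Open Scope classical_set_scope.
Local Open Scope ring_scope.

Definition Gamma (R : realType) (z : R) : R :=
  \int[lebesgue_measure]_(u in `]0, +oo[) (u `^ (z - 1) * expR (- u)).

(* A process on [0, +oo[ is a family [X : R -> {RV P >-> R}] of which only the
   members [X t] with [0 <= t] matter. *)

(* The point mass is a separate case because the library's [normal_prob m 0] is
   the uniform law on [0, 1]. *)
Definition is_gaussian (R : realType) (d : measure_display)
    (T : measurableType d) (P : probability T R) (X : T -> R) : Prop :=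
  exists m s : R, 0 <= s /\
    forall B : set R, measurable B ->
      P (X @^-1` B) = if s == 0 then \d_m B else normal_prob m s B.

Definition gaussian_process (R : realType) (d : measure_display)
    (T : measurableType d) (P : probability T R)
    (X : R -> {RV P >-> R}) : Prop :=
  forall (n : nat) (c t : 'I_n -> R), (forall i, 0 <= t i) ->
    is_gaussian P (fun w => \sum_(i < n) c i * X (t i) w).

(* No path regularity is required of [W]. *)
Definition is_fBm (R : realType) (d : measure_display)
    (T : measurableType d) (P : probability T R) (H : R)
    (W : R -> {RV P >-> R}) : Prop :=
  [/\ gaussian_process W,
      forall t, 0 <= t -> ('E_P[W t] = 0)%E
    & forall t s, 0 <= t -> 0 <= s ->
        ('E_P[fun w => (W t w * W s w)%R] =
         (2^-1 * (t `^ (2 * H) + s `^ (2 * H) - `|t - s| `^ (2 * H)))%R%:E)%E].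

(* Almost surely continuous paths make the pathwise integral meaningful.  The
   equation is asked for each time almost surely, with a null set that may
   depend on the time; at [t = 0] it gives the initial condition. *)
Definition is_solution (R : realType) (d : measure_display)
    (T : measurableType d) (P : probability T R)
    (a sigma x0 : R) (W x : R -> {RV P >-> R}) : Prop :=
  {ae P, forall w, {within `[0, +oo[, continuous (fun t => x t w)}} /\
  forall t, 0 <= t ->
    {ae P, forall w,
      x t w = x0 + a * \int[lebesgue_measure]_(s in `[0, t]) x s w
              + sigma * W t w}.

Definition autocov (R : realType) (d : measure_display)
    (T : measurableType d) (P : probability T R)
    (x : R -> {RV P >-> R}) (tau t : R) : \bar R :=
  ('E_P[fun w => (x t w * x (t + tau)%R w)%R]
   - 'E_P[x t] * 'E_P[x (t + tau)%R])%E.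

Definition Vinf (R : realType) (d : measure_display)
    (T : measurableType d) (P : probability T R)
    (x : R -> {RV P >-> R}) (tau : R) : \bar R :=
  lim (autocov x tau t @[t --> +oo]).

Definition ACinf (R : realType) (d : measure_display)
    (T : measurableType d) (P : probability T R)
    (x : R -> {RV P >-> R}) (tau : R) : R :=
  fine (Vinf x tau) / fine (Vinf x 0).

(* [lim], [fine] and [/] are total, so their values alone do not say that the
   limits and the quotient exist. *)
Definition ACinf_defined (R : realType) (d : measure_display)
    (T : measurableType d) (P : probability T R)
    (x : R -> {RV P >-> R}) (tau : R) : Prop :=
  [/\ cvg (autocov x tau t @[t --> +oo]) /\ Vinf x tau \is a fin_num,
      cvg (autocov x 0 t @[t --> +oo]) /\ Vinf x 0 \is a fin_num
    & Vinf x 0 != 0%E].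

(* Unlike the library's [=O_F], the quotient has to converge, not just stay
   bounded. *)
Definition bigO_left (R : realType) (p : R) (b1 b2 : R -> R) : Prop :=
  exists2 l : R, 0 <= l & `|b1 q / b2 q| @[q --> p^'-] --> l.

(* Main.v *)
Require Import Defs.
From HB Require Import structures.
From mathcomp Require Import all_boot all_order all_algebra.
From mathcomp Require Import all_classical all_reals all_analysis.
From mathcomp Require Import measurable_realfun ring lra.

Import Order.TTheory GRing.Theory Num.Theory.
Import numFieldNormedType.Exports.

(** Fix a parameter value and put th = - A(lambda) > 0, h = 2 H.  Subtracting
    the mean x0 exp(- th t) from x leaves a process Z with continuous paths and
    Z_t = sigma W_t - th Y_t, where Y_t is the integral of Z over [0, t].  So Y
    solves Y' = sigma W - th Y: it is the exponentially filtered noise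
      Y_t = int_0^t exp(- th (t - s)) sigma W_s ds.
    Exchanging expectation and integration over time along this formula gives
    E[W_t Y_u] as an integral of the covariance of W; integrating
      (exp(2 th t) Y_t Y_{t+tau})'
        = exp(2 th t) (sigma W_t Y_{t+tau} + Y_t sigma W_{t+tau})
    then gives E[Y_t Y_{t+tau}].  This determines the autocovariance
    E[Z_t Z_{t+tau}] ([solution_autocov]).

    All these integrals are explicit in terms of one function, the primitive
    N of exp(- th v) |v|^h on the whole line.  Since |t - s|^h is even, a
    reflection s |-> t - s turns the integral of exp(th s) |t - s|^h into
    increments of N, whatever the order of s and t, so no case distinction and
    no double integral is needed.  The part of the covariance growing like t^h
    cancels ([ou_covE]), and as t tends to infinity
      V(tau) = sigma^2 / 2 * (- tau^h + th / 2 *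
        (exp(- th tau) (N(oo) - N(- tau)) + exp(th tau) (N(oo) - N(tau)))).
    By scaling, N(t) = th^(-h-1) g(th t) with g the primitive of
    exp(- v) |v|^h, whose limit at infinity is Gamma(h + 1); in particular
    V(0) = sigma^2 / 2 * th^(-h) Gamma(h + 1) > 0.

    Dividing, the remainder of the autocorrelation is a function of z = th tau:
      D(z) = cosh z - 1
             - (exp(- z) g(- z) + exp(z) g(z)) / (2 Gamma(h + 1)).
    It satisfies D(0) = D'(0) = 0 and D''(0) = 1, so that D(th tau) / th^2 tends
    to tau^2 / 2 ([ac_rem_cvg]), which is the claim with an explicit limit. *)

Set Implicit Arguments.
Unset Strict Implicit.
Unset Printing Implicit Defensive.

Local Open Scope classical_set_scope.
Local Open Scope ring_scope.

(** * Primitives of continuous functions on the line *)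

Section Primitive.
Context {R : realType}.
Implicit Types (f F g : R -> R) (a b t : R).
Local Notation mu := (@lebesgue_measure R).

(** The integral from 0 to t for t of either sign, written so that t and 0 are
    both interior to the domain of integration: the fundamental theorem of
    calculus then applies at every point of the line. *)
Definition primitive f t : R :=
  \int[mu]_(s in `[- (`|t| + 1), t]) f s
  - \int[mu]_(s in `[- (`|t| + 1), 0]) f s.

Lemma continuous_itv_integrable f a b : continuous f ->
  mu.-integrable `[a, b] (EFin \o f).
Proof.
move=> cf; apply: continuous_compact_integrable; first exact: segment_compact.
exact: continuous_subspaceT.
Qed.

Lemma derive_continuous F g :
  (forall t, is_derive t (1 : R) F (g t)) -> continuous F.
Proof.
move=> dF t; apply: differentiable_continuous; apply/derivable1_diffP.
exact: (ex_derive (is_derive := dF t)).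
Qed.

Lemma Rintegral_derive F f a b : continuous f ->
  (forall t, is_derive t (1 : R) F (f t)) -> a <= b ->
  \int[mu]_(s in `[a, b]) f s = F b - F a.
Proof.
move=> cf dF; rewrite le_eqVlt => /predU1P[->|ab].
  by rewrite set_itv1 Rintegral_set1 subrr.
have cF := derive_continuous dF.
rewrite /Rintegral (@continuous_FTC2 _ f F)//.
- exact: continuous_subspaceT.
- split.
  + by move=> x _; exact: (ex_derive (is_derive := dF x)).
  + exact/cvg_at_right_filter/cF.
  + exact/cvg_at_left_filter/cF.
- by move=> x _; rewrite derive1E (derive_val (is_derive := dF x)).
Qed.

(** Near a given point the left end of the window can be frozen, which makes
    [primitive] differentiable although its definition lets the window depend
    on t. *)
Lemma primitive_window f t c : continuous f -> `|t| <= c ->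
  primitive f t = \int[mu]_(s in `[- c, t]) f s
                  - \int[mu]_(s in `[- c, 0]) f s.
Proof.
move=> cf.
have split_at (b u v : R) : b <= 0 -> b <= v -> v <= u ->
    \int[mu]_(s in `[b, u]) f s =
    \int[mu]_(s in `[b, v]) f s + \int[mu]_(s in `]v, u]) f s.
  move=> b0 bv vu; apply/eqP; rewrite addrC -subr_eq; apply/eqP.
  by rewrite Rintegral_itvB//; exact: continuous_itv_integrable.
have indep (b b' : R) : b <= t -> b <= 0 -> b' <= t -> b' <= 0 ->
    \int[mu]_(s in `[b, t]) f s - \int[mu]_(s in `[b, 0]) f s =
    \int[mu]_(s in `[b', t]) f s - \int[mu]_(s in `[b', 0]) f s.
  move=> bt b0 b't b'0; case: (leP t 0) => [t0|/ltW t0].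
    rewrite (split_at b 0 t)// (split_at b' 0 t)//.
    by rewrite !opprD !addrA !subrr.
  rewrite (split_at b t 0)// (split_at b' t 0)//.
  by rewrite ![_ + _ - _]addrAC !subrr.
rewrite ler_norml => /andP[ct tc]; apply: indep.
all: have := ler_norm (- t); have := normr_ge0 t; rewrite normrN; lra.
Qed.

Lemma primitive_itv f t : continuous f -> 0 <= t ->
  primitive f t = \int[mu]_(s in `[0, t]) f s.
Proof.
move=> cf t0; rewrite /primitive; set b := - (`|t| + 1).
have b0 : b <= 0 by have := normr_ge0 t; rewrite /b; lra.
rewrite Rintegral_itvB//; last exact: continuous_itv_integrable.
rewrite Rintegral_itv_obnd_cbnd//.
apply: (@integrableS _ _ _ mu `[0, t]) => //;
  last exact: continuous_itv_integrable.
exact: subset_itv_oc_cc.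
Qed.

Lemma primitive0 f : primitive f 0 = 0.
Proof. by rewrite /primitive subrr. Qed.

Lemma is_derive_primitive f t : continuous f ->
  is_derive t (1 : R) (primitive f) (f t).
Proof.
move=> cf; pose c := `|t| + 2.
have near_c : \near t, \int[mu]_(s in `[- c, t]) f s
    - \int[mu]_(s in `[- c, 0]) f s = primitive f t.
  near=> u; rewrite -primitive_window//.
  have : `|u - t| < 1.
    near: u; apply/nbhs_normP; exists 1 => //= u /=.
    by rewrite distrC.
  by have := ler_normD (u - t) t; rewrite subrK /c; lra.
apply: near_eq_is_derive near_c _.
have [||||df f'] := @continuous_FTC1_closed R f (- c) t (t + 1).
- by rewrite ltrDl.
- exact: continuous_itv_integrable.
- by have := ler_norm (- t); rewrite normrN /c; lra.
- exact: cf.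
rewrite -[f t]subr0 -[f t]f' derive1E.
by apply: is_deriveB; exact: derivableP.
Unshelve. all: by end_near. Qed.

Lemma primitive_unique f F t : continuous f ->
  (forall t, is_derive t (1 : R) F (f t)) -> primitive f t = F t - F 0.
Proof.
move=> cf dF; have c0 : - (`|t| + 1) <= 0 by have := normr_ge0 t; lra.
have ct : - (`|t| + 1) <= t by have := ler_norm (- t); rewrite normrN; lra.
rewrite /primitive !(Rintegral_derive cf dF)//; lra.
Qed.

End Primitive.

(** * Pointwise rules of calculus *)

(** The rules below are stated for pointwise expressions such as
    [fun t => f t * g t]: this is the form in which explicit formulas occur, and
    the tactics [deriv_with] and [cont_with] match it syntactically. *)
Section DeriveRules.
Context {R : realType}.
Implicit Types (f g F dF : R -> R) (x df dg k : R).

Lemma d1_cst k x : is_derive x (1 : R) (fun=> k) 0.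
Proof. exact: is_derive_cst. Qed.

Lemma d1_id x : is_derive x (1 : R) (fun t : R => t) 1.
Proof. exact: is_derive_id. Qed.

Lemma d1_opp f x df : is_derive x (1 : R) f df ->
  is_derive x (1 : R) (fun t => - f t) (- df).
Proof. exact: is_deriveN. Qed.

Lemma d1_add f g x df dg : is_derive x (1 : R) f df ->
  is_derive x (1 : R) g dg ->
  is_derive x (1 : R) (fun t => f t + g t) (df + dg).
Proof. exact: is_deriveD. Qed.

Lemma d1_mul f g x df dg : is_derive x (1 : R) f df ->
  is_derive x (1 : R) g dg ->
  is_derive x (1 : R) (fun t => f t * g t) (f x * dg + g x * df).
Proof. exact: is_deriveM. Qed.

Lemma d1_comp F dF f x df : (forall t, is_derive t (1 : R) F (dF t)) ->
  is_derive x (1 : R) f df ->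
  is_derive x (1 : R) (fun t => F (f t)) (dF (f x) * df).
Proof. by move=> dFt dfx; exact: is_derive1_comp. Qed.

Lemma d1_expR f x df : is_derive x (1 : R) f df ->
  is_derive x (1 : R) (fun t => expR (f t)) (expR (f x) * df).
Proof. exact: d1_comp. Qed.

End DeriveRules.

Section Continuity.
Context {R : realType}.
Implicit Types f g : R -> R.

Lemma cont_mul f g : continuous f -> continuous g ->
  continuous (fun t => f t * g t).
Proof. by move=> cf cg t; apply: cvgM; [exact: cf|exact: cg]. Qed.

Lemma cont_add f g : continuous f -> continuous g ->
  continuous (fun t => f t + g t).
Proof. by move=> cf cg t; apply: cvgD; [exact: cf|exact: cg]. Qed.

Lemma cont_opp f : continuous f -> continuous (fun t => - f t).
Proof. by move=> cf t; apply: cvgN; exact: cf. Qed.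

Lemma cont_comp f g : continuous f -> continuous g ->
  continuous (fun t => f (g t)).
Proof. by move=> cf cg t; apply: continuous_comp; [exact: cg|exact: cf]. Qed.

Lemma cont_cst (k : R) : continuous (fun _ : R => k).
Proof. by move=> t; exact: cvg_cst. Qed.

Lemma cont_id : continuous (fun t : R => t).
Proof. by move=> t; exact: cvg_id. Qed.

Lemma continuous_expRM (k : R) : continuous (fun t : R => expR (k * t)).
Proof.
apply: cont_comp; first exact: continuous_expR.
by apply: cont_mul; [exact: cont_cst|exact: cont_id].
Qed.

End Continuity.

(** The argument [h] is a proof that some function has a given derivative at
    every point; it is used for the compositions with that function. *)
Ltac deriv_step h := lazymatch goal with
  | |- is_derive _ _ (fun _ => ?k) _ => notypeclasses refine (d1_cst _ _)
  | |- is_derive _ _ (fun t => t) _ => notypeclasses refine (d1_id _)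
  | |- is_derive _ _ (fun t => @?f t + @?g t) _ =>
      notypeclasses refine (@d1_add _ f g _ _ _ _ _)
  | |- is_derive _ _ (fun t => - @?f t) _ =>
      notypeclasses refine (@d1_opp _ f _ _ _)
  | |- is_derive _ _ (fun t => @?f t * @?g t) _ =>
      notypeclasses refine (@d1_mul _ f g _ _ _ _ _)
  | |- is_derive _ _ (fun t => expR (@?f t)) _ =>
      notypeclasses refine (@d1_expR _ f _ _ _)
  | |- is_derive _ _ (fun t => ?F (@?f t)) _ =>
      notypeclasses refine (@d1_comp _ F _ f _ _ h _)
  end; cbv beta.

(** Leaves the equation between the computed derivative and the stated one. *)
Ltac deriv_with h := eapply is_derive_eq; [ repeat deriv_step h | rewrite /= ].

Ltac cont_step h := lazymatch goal with
  | |- continuous (fun _ => ?k) => exact (@cont_cst _ k)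
  | |- continuous (fun t => t) => exact (@cont_id _)
  | |- continuous (fun t => @?f t + @?g t) =>
      notypeclasses refine (@cont_add _ f g _ _)
  | |- continuous (fun t => - @?f t) => notypeclasses refine (@cont_opp _ f _)
  | |- continuous (fun t => @?f t * @?g t) =>
      notypeclasses refine (@cont_mul _ f g _ _)
  | |- continuous (fun t => ?F (@?f t)) =>
      notypeclasses refine (@cont_comp _ F f _ _)
  | |- continuous _ => h
  end; cbv beta.

Ltac cont_with h := repeat cont_step h.

Lemma d1_expRM {R : realType} (k x : R) :
  is_derive x (1 : R) (fun t => expR (k * t)) (expR (k * x) * k).
Proof. by deriv_with I; ring. Qed.

Section Monotone.
Context {R : realType}.
Implicit Types (f g : R -> R).

Lemma derive_ge0_nondecreasing f g a b : a <= b ->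
  (forall t, is_derive t (1 : R) f (g t)) ->
  (forall t, a <= t <= b -> 0 <= g t) -> f a <= f b.
Proof.
move=> ab df g0; have cf := derive_continuous df.
have [|c] := @MVT_segment R f g a b ab (fun x _ => df x).
  exact: continuous_subspaceT.
rewrite in_itv/= => /g0 gc /eqP; rewrite subr_eq => /eqP ->.
by rewrite lerDr mulr_ge0// subr_ge0.
Qed.

End Monotone.

(** * The power |t|^h and the Gamma integral *)

Section Power.
Context {R : realType}.
Variable h : R.
Hypotheses (h0 : 0 < h) (h2 : h < 2).
Implicit Types (t v : R).

(** Extending the power evenly makes it continuous on the line and turns
    |t - s|^h into a plain translate. *)
Definition abspow t : R := `|t| `^ h.

Lemma abspow_ge0 t : 0 <= abspow t.
Proof. exact: powR_ge0. Qed.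

Lemma abspowN t : abspow (- t) = abspow t.
Proof. by rewrite /abspow normrN. Qed.

Lemma abspow0 : abspow 0 = 0.
Proof. by rewrite /abspow normr0 powR0 ?gt_eqF. Qed.

Lemma abspowM a t : 0 <= a -> abspow (a * t) = a `^ h * abspow t.
Proof. by move=> a0; rewrite /abspow normrM powRM// (ger0_norm a0). Qed.

Lemma abspow_le s t : 0 <= s -> s <= t -> abspow s <= abspow t.
Proof.
move=> s0 st; rewrite /abspow !ger0_norm//; last exact: le_trans st.
by apply: ge0_ler_powR; rewrite ?nnegrE// ?(ltW h0)//; exact: le_trans st.
Qed.

Lemma abspow_le_sqr t : abspow t <= 1 + t ^+ 2.
Proof.
rewrite /abspow -(real_normK (num_real t)).
have := normr_ge0 t; set s := `|t| => s0.
have [s1|/ltW s1] := leP s 1.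
  apply: (@le_trans _ _ 1); last by rewrite lerDl sqr_ge0.
  have <- : 1 `^ h = 1 by rewrite powR1.
  by apply: ge0_ler_powR; rewrite ?nnegrE// ltW.
apply: (@le_trans _ _ (s ^+ 2)); last by rewrite lerDr.
by rewrite -powR_mulrn// ler_powR// ltW.
Qed.

Lemma continuous_abspow : continuous abspow.
Proof.
move=> t; have [->|t0] := eqVneq t 0.
  apply/cvgrPdist_lt => e e0; near=> s.
  rewrite abspow0 sub0r normrN ger0_norm ?abspow_ge0// /abspow.
  have -> : e = (e `^ h^-1) `^ h.
    by rewrite -powRrM mulVf ?gt_eqF// powRr1// ltW.
  apply: gt0_ltr_powR; rewrite ?nnegrE ?powR_ge0 ?h0//.
  near: s; apply/nbhs_normP; exists (e `^ h^-1); first exact: powR_gt0.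
  by move=> s /=; rewrite sub0r normrN.
apply: (@cvg_comp _ _ _ Num.norm (fun u : R => u `^ h) _ (nbhs (`|t| : R))).
  exact: norm_continuous.
suff : {for `|t|, continuous (fun u : R => u `^ h)} by [].
apply: differentiable_continuous; apply/derivable1_diffP.
by apply: derivable_powR; rewrite in_itv/= andbT normr_gt0.
Unshelve. all: by end_near. Qed.

(** For t >= 0 this is the lower incomplete gamma function of parameter h + 1;
    its values at negative arguments are used as well. *)
Definition lower_gamma : R -> R := primitive (fun v => expR (- v) * abspow v).

Lemma continuous_gamma_integrand : continuous (fun v => expR (- v) * abspow v).
Proof.
apply: cont_mul continuous_abspow => v.
by apply: continuous_comp; [exact: opp_continuous|exact: continuous_expR].
Qed.

Lemma is_derive_lower_gamma t :
  is_derive t (1 : R) lower_gamma (expR (- t) * abspow t).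
Proof. exact/is_derive_primitive/continuous_gamma_integrand. Qed.

Lemma lower_gamma_nondecreasing : {homo lower_gamma : s t / s <= t}.
Proof.
move=> s t st.
apply: (derive_ge0_nondecreasing st is_derive_lower_gamma) => u _.
by rewrite mulr_ge0 ?expR_ge0 ?abspow_ge0.
Qed.

(** As |v|^h <= 1 + v^2, compare with the primitive
    - exp(- v) (v^2 + 2 v + 3) of exp(- v) (1 + v^2), which increases from - 3
    to 0. *)
Lemma lower_gamma_le3 t : 0 <= t -> lower_gamma t <= 3.
Proof.
move=> t0.
pose f u := - (lower_gamma u + expR (- u) * (u * u + 2 * u + 3)).
have df (u : R) : is_derive u (1 : R) f (expR (- u) * (1 + u ^+ 2 - abspow u)).
  by rewrite /f; deriv_with is_derive_lower_gamma; ring.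
have := derive_ge0_nondecreasing t0 df; rewrite /f.
rewrite /lower_gamma primitive0 oppr0 expR0 => fle.
have : 0 <= expR (- t) * (t * t + 2 * t + 3).
  by rewrite mulr_ge0 ?expR_ge0//; nra.
suff : forall u, 0 <= u <= t -> 0 <= expR (- u) * (1 + u ^+ 2 - abspow u).
  by move/fle; lra.
by move=> u _; rewrite mulr_ge0 ?expR_ge0// subr_ge0 abspow_le_sqr.
Qed.

Lemma lower_gamma1_gt0 : 0 < lower_gamma 1.
Proof.
have [|c] := @MVT R lower_gamma _ 0 1 ltr01
  (fun x _ => is_derive_lower_gamma x).
  exact/continuous_subspaceT/(derive_continuous is_derive_lower_gamma).
rewrite in_itv/= /lower_gamma primitive0 subr0 => /andP[c0 _] ->.
by rewrite subr0 mulr1 mulr_gt0 ?expR_gt0// /abspow powR_gt0// normr_gt0 gt_eqF.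
Qed.

Lemma lower_gamma_cvg : lower_gamma t @[t --> +oo] --> Gamma (h + 1).
Proof.
have [l ll] : exists l : R, lower_gamma t @[t --> +oo] --> l.
  eexists; apply: (nondecreasing_cvgr lower_gamma_nondecreasing).
  exists 3 => _ [t _ <-]; have [t0|/ltW t0] := leP 0 t.
    exact: lower_gamma_le3.
  apply: (le_trans (lower_gamma_nondecreasing t0)).
  exact: lower_gamma_le3.
suff -> : Gamma (h + 1) = l by [].
have c1 := continuous_gamma_integrand.
have -> : Gamma (h + 1) =
    \int[lebesgue_measure]_(v in `]0, +oo[) (expR (- v) * abspow v).
  apply: eq_Rintegral => v; rewrite inE/= in_itv/= andbT => v0.
  by rewrite addrK mulrC /abspow ger0_norm// ltW.
rewrite /Rintegral integral_itv_obnd_cbnd; last first.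
  apply/measurable_EFinP/measurable_funTS.
  exact: continuous_measurable_fun.
rewrite -/(Rintegral _ _ _).
rewrite (@Rintegral_ge0_continuous_FTC2y _ _ lower_gamma _ l)//.
- by rewrite /lower_gamma primitive0 subr0.
- by move=> v v0; rewrite mulr_ge0 ?expR_ge0 ?abspow_ge0.
- exact: continuous_subspaceT.
- by move=> v _; exact: (ex_derive (is_derive := is_derive_lower_gamma v)).
- exact/cvg_at_right_filter/(derive_continuous is_derive_lower_gamma).
- move=> v _; rewrite derive1E.
  exact: (derive_val (is_derive := is_derive_lower_gamma v)).
Qed.

Lemma Gamma_gt0 : 0 < Gamma (h + 1).
Proof.
apply: (lt_le_trans lower_gamma1_gt0).
apply: (cvgr_to_ge lower_gamma_cvg); near=> t.
apply: lower_gamma_nondecreasing; near: t.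
exact: nbhs_pinfty_ge.
Unshelve. all: by end_near. Qed.

End Power.

(** * The covariance of the Ornstein-Uhlenbeck process and its limit *)

Section Covariance.
Context {R : realType}.
Variables h th tau : R.
Hypotheses (h0 : 0 < h) (h2 : h < 2) (th0 : 0 < th).
Implicit Types (r s t u v : R).
Local Notation mu := (@lebesgue_measure R).

Local Notation p := (abspow h).

Definition fbm_cov t s : R := 2^-1 * (p t + p s - p (t - s)).

(** The function N of the introduction. *)
Definition expprim : R -> R := primitive (fun v => expR (- th * v) * p v).

(* Turning the values of the functions into variables makes [field] fast. *)
Ltac generalize_values := repeat match goal with
  | |- context [expprim ?x] => move: (expprim x) => ?
  | |- context [p ?x] => move: (p x) => ?
  end.

Lemma continuous_expM_abspow k : continuous (fun v => expR (k * v) * p v).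
Proof.
by apply: cont_mul; [exact: continuous_expRM|exact: continuous_abspow].
Qed.

Lemma is_derive_expprim t : is_derive t (1 : R) expprim (expR (- th * t) * p t).
Proof. exact/is_derive_primitive/continuous_expM_abspow. Qed.

Lemma expprim0 : expprim 0 = 0.
Proof. exact: primitive0. Qed.

Lemma expprim_scale t : expprim t = th `^ (- (h + 1)) * lower_gamma h (th * t).
Proof.
rewrite /expprim.
pose F v := th `^ (- (h + 1)) * lower_gamma h (th * v).
have dF v : is_derive v (1 : R) F (expR (- th * v) * p v).
  rewrite /F; deriv_with (is_derive_lower_gamma h0).
  rewrite abspowM ?ltW// mulr1 mulr0 addr0 mulr0 addr0 mulNr.
  have : th `^ (- (h + 1)) * th `^ h * th = 1.
    rewrite powRN powRD; last by rewrite (gt_eqF th0) implybT.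
    by rewrite powRr1 ?ltW// -mulrA mulVf// gt_eqF// mulr_gt0// powR_gt0.
  by move=> e; rewrite -[RHS]mulr1 -[X in _ = _ * X]e; ring.
rewrite (primitive_unique t (@continuous_expM_abspow (- th)) dF).
by rewrite /F mulr0 {2}/lower_gamma primitive0 mulr0 subr0.
Qed.

Definition expprim_lim : R := th `^ (- (h + 1)) * Gamma (h + 1).

Lemma expprim_cvg : expprim t @[t --> +oo] --> expprim_lim.
Proof.
under eq_fun do rewrite expprim_scale.
apply: cvgM; first exact: cvg_cst.
apply: (@cvg_comp _ _ _ (fun t => th * t) (lower_gamma h) _ +oo).
  exact: gt0_cvgMry.
exact: lower_gamma_cvg.
Qed.

Lemma expprimN_le t : 0 <= t ->
  0 <= - expprim (- t) <= t * (expR (th * t) * p t).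
Proof.
move=> t0; have c := derive_continuous is_derive_expprim.
have [||c0] := @MVT_segment R expprim _ (- t) 0 _
  (fun x _ => is_derive_expprim x).
- by rewrite oppr_le0.
- exact: continuous_subspaceT.
rewrite in_itv/= expprim0 !sub0r opprK => /andP[tc c00] ->.
rewrite [_ * t]mulrC; apply/andP; split.
  by rewrite !mulr_ge0 ?expR_ge0 ?abspow_ge0.
apply: ler_wpM2l => //; apply: ler_pM; rewrite ?expR_ge0 ?abspow_ge0//.
  by rewrite ler_expR mulNr -mulrN ler_pM2l//; lra.
by rewrite -abspowN; apply: abspow_le => //; lra.
Qed.

(** The covariance of W_t and int_0^u exp(- th (u - r)) W_r dr, for W a
    fractional Brownian motion. *)
Definition fbm_filter_cov t u : R := 2^-1 *
  (p t * ((1 - expR (- th * u)) / th) - expR (- th * u) * expprim (- u)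
   - expR (- th * (u - t)) * (expprim t - expprim (t - u))).

Let expM_D a b : expR (th * (a + b)) = expR (th * a) * expR (th * b).
Proof. by rewrite mulrDr expRD. Qed.

Let expM_N a : expR (- th * a) = (expR (th * a))^-1.
Proof. by rewrite mulNr expRN. Qed.

Let expM_NN a : expR (th * - a) = (expR (th * a))^-1.
Proof. by rewrite mulrN expRN. Qed.

Let expM_2 a : expR (2 * th * a) = expR (th * a) ^+ 2.
Proof. by rewrite -mulrA mulr_natl mulr2n expRD. Qed.

Let expM_N2 a : expR (- 2 * th * a) = (expR (th * a))^-1 ^+ 2.
Proof. by rewrite !mulNr expRN expM_2 exprVn. Qed.

Let expM := (expM_N2, expM_2, expM_N, expM_D, expM_NN).

Let exp_neq0 (x : R) : expR x != 0.
Proof. by rewrite gt_eqF ?expR_gt0. Qed.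

Let th_neq0 : th != 0.
Proof. by rewrite gt_eqF. Qed.

Lemma continuous_fbm_cov t : continuous (fbm_cov t).
Proof.
rewrite /fbm_cov.
by cont_with ltac:(exact: continuous_abspow).
Qed.

(** The three terms of the covariance of W are integrated separately; after
    r |-> - r and r |-> t - r the last two become increments of [expprim], which
    is why [expprim] has to be defined on the whole line. *)
Lemma fbm_filter_covE t u : 0 <= u ->
  \int[mu]_(r in `[0, u]) (expR (th * r) * fbm_cov t r)
  = expR (th * u) * fbm_filter_cov t u.
Proof.
move=> u0.
pose F r := 2^-1 * (p t * (expR (th * r) * th^-1) - expprim (- r)
   + expR (th * t) * expprim (t - r)).
have cf : continuous (fun r => expR (th * r) * fbm_cov t r).
  by apply: cont_mul; [exact: continuous_expRM|exact: continuous_fbm_cov].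
have dF (r : R) : is_derive r (1 : R) F (expR (th * r) * fbm_cov t r).
  rewrite /F; deriv_with is_derive_expprim.
  rewrite /fbm_cov abspowN !expM; field.
  by rewrite !exp_neq0 th_neq0.
rewrite (Rintegral_derive cf dF)// /F /fbm_filter_cov oppr0 addr0 expprim0.
rewrite mulr0 expR0 !expM; field.
by rewrite !exp_neq0 th_neq0.
Qed.

Lemma continuous_fbm_filter_cov (f g : R -> R) : continuous f -> continuous g ->
  continuous (fun s => fbm_filter_cov (f s) (g s)).
Proof.
move=> cf cg; rewrite /fbm_filter_cov.
by cont_with ltac:(first [exact: cf | exact: cg | exact: continuous_expR
  | exact: continuous_abspow | exact: derive_continuous is_derive_expprim]).
Qed.

(** The integrals over [0, u] of exp(- th (u - s)) and exp(- th (u - s)) s^h,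
    and those over [0, t] of exp(- 2 th (t - s)) N(s) and
    exp(- 2 th (t - s)). *)
Definition expmean u : R := (1 - expR (- th * u)) / th.
Definition expconv u : R := - (expR (- th * u) * expprim (- u)).
Definition exp2conv t : R :=
  (expprim t + expR (- 2 * th * t) * expprim (- t)) / (2 * th).
Definition exp2mean t : R := (1 - expR (- 2 * th * t)) / (2 * th).

(** The covariance of F_t and F_{t + tau}, for F_t the filtered process
    int_0^t exp(- th (t - s)) W_s ds. *)
Definition filter_cov t : R := 2^-1 *
  (expconv t * expmean (t + tau) + expconv (t + tau) * expmean t
   - expR (- th * tau) * (exp2conv t - expprim (- tau) * exp2mean t)
   - expR (th * tau) * (exp2conv (t + tau) - expR (- 2 * th * t) * exp2conv tau
                        - expprim tau * exp2mean t)).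

(** As (F_t F_{t+tau})' + 2 th F_t F_{t+tau} = W_t F_{t+tau} + F_t W_{t+tau},
    the covariance of the filtered process is obtained by integrating
    [fbm_filter_cov] with weight exp(2 th s). *)
Lemma filter_covE t : 0 <= t ->
  \int[mu]_(s in `[0, t]) (expR (2 * th * s) *
     (fbm_filter_cov s (s + tau) + fbm_filter_cov (s + tau) s))
  = expR (2 * th * t) * filter_cov t.
Proof.
move=> t0.
have shift : continuous (fun s : R => s + tau).
  exact: (cont_add (@cont_id R) (@cont_cst R tau)).
have cf : continuous (fun s => expR (2 * th * s) *
     (fbm_filter_cov s (s + tau) + fbm_filter_cov (s + tau) s)).
  exact: (cont_mul (@continuous_expRM R (2 * th)) (cont_add
    (continuous_fbm_filter_cov (@cont_id R) shift)
    (continuous_fbm_filter_cov shift (@cont_id R)))).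
have dF (r : R) : is_derive r (1 : R)
   (fun t => expR (2 * th * t) * filter_cov t)
   (expR (2 * th * r) *
     (fbm_filter_cov r (r + tau) + fbm_filter_cov (r + tau) r)).
  rewrite /filter_cov /expconv /exp2conv /expmean /exp2mean /fbm_filter_cov.
  deriv_with is_derive_expprim.
  rewrite [r - (r + tau)](_ : _ = - tau); last by ring.
  rewrite [r + tau - r](_ : _ = tau); last by ring.
  rewrite !abspowN opprD !expM.
  have := exp_neq0 (th * tau); have := exp_neq0 (th * r).
  move: (expR (th * r)) (expR (th * tau)) => X Y X0 Y0.
  generalize_values; field.
  by rewrite X0 Y0 th_neq0.
have E0 : filter_cov 0 = 0.
  rewrite /filter_cov /expconv /exp2conv /expmean /exp2mean.
  rewrite !(oppr0, add0r, expprim0) !expM !mulr0 !expR0; field.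
  by rewrite !exp_neq0 th_neq0.
by rewrite (Rintegral_derive cf dF)// E0 mulr0 subr0.
Qed.

(** The covariance of W_t - th F_t and W_{t+tau} - th F_{t+tau}. *)
Definition ou_cov t : R :=
  fbm_cov t (t + tau) - th * fbm_filter_cov t (t + tau)
  - th * fbm_filter_cov (t + tau) t + th ^+ 2 * filter_cov t.

Definition ou_tail t : R :=
  expR (- th * t) * p t + th / 2 * (expR (- 2 * th * t) * expprim (- t)).

Definition ou_cov_lim : R := 2^-1 * (- p tau + th / 2 *
  (expR (- th * tau) * (expprim_lim - expprim (- tau))
   + expR (th * tau) * (expprim_lim - expprim tau))).

(** The terms in t^h only survive multiplied by exp(- th t): filtering a
    constant c yields c (1 - exp(- th t)) / th, so W - th F forgets the level
    of W exponentially fast. *)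
Lemma ou_covE t : ou_cov t =
  2^-1 * (- p tau + th / 2 *
     (expR (- th * tau) * (expprim t - expprim (- tau))
      + expR (th * tau) * (expprim (t + tau) - expprim tau)))
  + 2^-1 * (expR (- th * tau) * ou_tail t
            + expR (th * tau) * ou_tail (t + tau)).
Proof.
rewrite /ou_cov /ou_tail /fbm_cov /filter_cov /fbm_filter_cov /expconv /expmean.
rewrite /exp2conv /exp2mean.
rewrite [t - (t + tau)](_ : _ = - tau); last by ring.
rewrite [t + tau - t](_ : _ = tau); last by ring.
rewrite !abspowN opprD !expM.
have := exp_neq0 (th * tau); have := exp_neq0 (th * t).
move: (expR (th * t)) (expR (th * tau)) => X Y X0 Y0.
generalize_values; field.
by rewrite X0 Y0 th_neq0.
Qed.

(** From exp(x) >= x^4 / 4!. *)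
Lemma expM_cube_le t : 1 <= t -> t ^+ 3 * expR (- th * t) <= 24 / th ^+ 4 / t.
Proof.
move=> t1; have t_gt0 : 0 < t by lra.
rewrite expM_N ler_pdivrMr ?expR_gt0// mulrAC ler_pdivlMr// -exprSr.
have := @expR_ge1Dxn R (th * t) 3 (mulr_ge0 (ltW th0) (ltW t_gt0)).
have -> : (4`!)%:R = 24 :> R by [].
move=> le_exp; have -> : t ^+ 4 = 24 / th ^+ 4 * ((th * t) ^+ 4 / 24).
  by field.
apply: ler_wpM2l; first by rewrite divr_ge0// exprn_ge0// ltW.
by apply: le_trans le_exp; rewrite lerDr.
Qed.

Lemma ou_tail_le t : 1 <= t ->
  `|ou_tail t| <= (2 + th) * (24 / th ^+ 4) * t^-1.
Proof.
move=> t1; have t_ge0 : 0 <= t by lra.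
have pt : p t <= 2 * t ^+ 2.
  by apply: (le_trans (abspow_le_sqr h0 h2 t)); nra.
have cube := expM_cube_le t1.
set K := 24 / th ^+ 4 / t in cube *.
have e0 := expR_ge0 (- th * t).
have At : expR (- th * t) * p t <= 2 * K.
  apply: le_trans (_ : 2 * (t ^+ 3 * expR (- th * t)) <= _); last by lra.
  rewrite [leLHS]mulrC mulrA ler_wpM2r//.
  by apply: (le_trans pt); apply: ler_wpM2l => //; exact: ler_weXn2l.
have /andP[B0 Bt] := expprimN_le t_ge0.
have {}Bt : expR (- 2 * th * t) * - expprim (- t) <= 2 * K.
  apply: (@le_trans _ _ (t * (expR (- th * t) * p t))).
    apply: (le_trans (ler_wpM2l (expR_ge0 _) Bt)).
    by rewrite expM_N2 expM_N le_eqVlt; apply/predU1P; left; field.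
  apply: le_trans (_ : 2 * (t ^+ 3 * expR (- th * t)) <= _).
    have -> : 2 * (t ^+ 3 * expR (- th * t))
      = t * (expR (- th * t) * (2 * t ^+ 2)) by ring.
    by apply: ler_wpM2l => //; exact: ler_wpM2l.
  by lra.
rewrite -mulrA -/K.
have B0' : 0 <= expR (- 2 * th * t) * - expprim (- t).
  by rewrite mulr_ge0// expR_ge0.
have A0 : 0 <= expR (- th * t) * p t by rewrite mulr_ge0// abspow_ge0.
rewrite /ou_tail; move: A0 At B0' Bt; rewrite mulrN.
set a := (_ * p t); set b := _ * expprim (- t) => A0 At B0' Bt.
clearbody K a b.
have thb0 : 0 <= th * - b by rewrite mulr_ge0// ltW.
have thb : th * - b <= th * (2 * K) by rewrite ler_wpM2l// ltW.
have K0 : 0 <= K by lra.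
have thK : 0 <= th * K by rewrite mulr_ge0// ltW.
by rewrite ler_norml; apply/andP; split; lra.
Qed.

Lemma ou_tail_cvg0 : ou_tail t @[t --> +oo] --> (0 : R).
Proof.
apply/norm_cvg0P.
apply: (@squeeze_cvgr _ _ _ _ (fun=> 0)
  (fun t => (2 + th) * (24 / th ^+ 4) * t^-1)).
- apply: filterS (nbhs_pinfty_ge (num_real (1 : R))) => t t1.
  by rewrite normr_ge0 ou_tail_le.
- exact: cvg_cst.
- rewrite -[X in _ --> X](mulr0 ((2 + th) * (24 / th ^+ 4))).
  apply: cvgM; first exact: cvg_cst.
  apply/gtr0_cvgV0; last exact: cvg_id.
  exact: (nbhs_pinfty_gt (num_real (0 : R))).
Qed.

Lemma cvg_shift_pinfty (f : R -> R) (l : R) : f t @[t --> +oo] --> l ->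
  f (t + tau) @[t --> +oo] --> l.
Proof.
move=> fl; apply: (@cvg_comp _ _ _ (fun t => t + tau) f _ +oo) => //.
exact: cvg_addrr.
Qed.

Lemma ou_cov_cvg : ou_cov t @[t --> +oo] --> ou_cov_lim.
Proof.
under eq_fun do rewrite ou_covE.
have cE := cvg_shift_pinfty expprim_cvg.
have c0 := cvg_shift_pinfty ou_tail_cvg0.
rewrite -[ou_cov_lim]addr0; apply: cvgD.
  apply: cvgM; first exact: cvg_cst.
  apply: cvgD; first exact: cvg_cst.
  apply: cvgM; first exact: cvg_cst.
  apply: cvgD.
    apply: cvgM; first exact: cvg_cst.
    by apply: cvgB; [exact: expprim_cvg|exact: cvg_cst].
  apply: cvgM; first exact: cvg_cst.
  by apply: cvgB; [exact: cE|exact: cvg_cst].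
rewrite -[X in _ --> X](_ :
  2^-1 * (expR (- th * tau) * 0 + expR (th * tau) * 0) = 0); last first.
  by rewrite !mulr0 addr0 mulr0.
apply: cvgM; first exact: cvg_cst.
apply: cvgD.
  by apply: cvgM; [exact: cvg_cst|exact: ou_tail_cvg0].
by apply: cvgM; [exact: cvg_cst|exact: c0].
Qed.

End Covariance.

(** * The remainder of the autocorrelation for small drift *)

Section Remainder.
Context {R : realType}.
Implicit Types (f : R -> R).

(** L'Hopital's rule, twice. *)
Lemma taylor2_at_right f f1 f2 : (forall t, is_derive t (1 : R) f (f1 t)) ->
  (forall t, is_derive t (1 : R) f1 (f2 t)) -> continuous f2 ->
  f 0 = 0 -> f1 0 = 0 -> f t / t ^+ 2 @[t --> 0^'+] --> f2 0 / 2.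
Proof.
move=> df df1 cf2 f0 f10.
have cf := derive_continuous df; have cf1 := derive_continuous df1.
have step (g dg u du : R -> R) (l : R) :
    (forall t, is_derive t (1 : R) g (dg t)) ->
    (forall t, is_derive t (1 : R) u (du t)) -> g 0 = 0 -> u 0 = 0 ->
    (forall t, 0 < t -> du t != 0) ->
    dg t / du t @[t --> 0^'+] --> l -> g t / u t @[t --> 0^'+] --> l.
  move=> dgP duP g0 u0 du0.
  apply: (@lhopital_at_right R g dg u du 0 1 l) => //.
  - rewrite -[X in _ --> X]g0.
    exact/cvg_at_right_filter/(derive_continuous dgP).
  - rewrite -[X in _ --> X]u0.
    exact/cvg_at_right_filter/(derive_continuous duP).
  - by move=> t; rewrite in_itv/= => /andP[t0 _]; exact: du0.
apply: (step _ f1 (fun t => t * t) (fun t => 2 * t)) => //.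
- by move=> t; deriv_with I; ring.
- by rewrite mulr0.
- by move=> t t0; rewrite gt_eqF// mulr_gt0.
apply: (step _ f2 (fun t => 2 * t) (fun=> 2)) => //.
- by move=> t; deriv_with I; ring.
- by rewrite mulr0.
apply: cvgM; last exact: cvg_cst.
by apply/cvg_at_right_filter/cf2.
Qed.

Variables (h tau : R).
Hypotheses (h0 : 0 < h) (h2 : h < 2).
Local Notation N := (lower_gamma h).
Local Notation p := (abspow h).
Local Notation G := (Gamma (h + 1)).

Let G0 : G != 0. Proof. by rewrite gt_eqF// Gamma_gt0. Qed.

(** The function D of the introduction at z = th tau. *)
Definition ac_rem (th : R) : R :=
  2^-1 * (expR (tau * th) + expR (- (tau * th))) - 1
  - (expR (- (tau * th)) * N (- (tau * th))
     + expR (tau * th) * N (tau * th)) * (2 * G)^-1.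

(** With E(z) = exp(- z) g(- z) + exp(z) g(z) one has E'' = E + 2 |z|^h: the
    power |z|^h, which need not be differentiable at 0, first appears in the
    second derivative, where it is continuous and vanishes at 0. *)
Lemma ac_rem_cvg : ac_rem th / th ^+ 2 @[th --> 0^'+] --> tau ^+ 2 / 2.
Proof.
pose f1 th := tau * (2^-1 * (expR (tau * th) - expR (- (tau * th)))
  - (expR (tau * th) * N (tau * th)
     - expR (- (tau * th)) * N (- (tau * th))) * (2 * G)^-1).
pose f2 th := tau ^+ 2 * (2^-1 * (expR (tau * th) + expR (- (tau * th)))
  - (expR (tau * th) * N (tau * th) + expR (- (tau * th)) * N (- (tau * th))
     + 2 * p (tau * th)) * (2 * G)^-1).
have N0 : N 0 = 0 by exact: primitive0.
have -> : tau ^+ 2 / 2 = f2 0 / 2.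
  rewrite /f2 mulr0 oppr0 expR0 N0 abspow0 //.
  by congr (_ / _); field.
apply: (@taylor2_at_right ac_rem f1 f2).
- move=> t; rewrite /ac_rem /f1; deriv_with (is_derive_lower_gamma h0).
  by rewrite !opprK abspowN expRN; field; rewrite G0 gt_eqF ?expR_gt0.
- move=> t; rewrite /f1 /f2; deriv_with (is_derive_lower_gamma h0).
  by rewrite !opprK abspowN expRN; field; rewrite G0 gt_eqF ?expR_gt0.
- rewrite /f2; cont_with ltac:(first [exact: continuous_expR
    | exact: continuous_abspow
    | exact: derive_continuous (is_derive_lower_gamma h0)]).
- by rewrite /ac_rem mulr0 oppr0 expR0 N0 !mulr0 addr0 mul0r subr0; lra.
- by rewrite /f1 mulr0 oppr0 expR0 N0; lra.
Qed.

Lemma ou_cov_lim0 (th : R) : 0 < th ->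
  ou_cov_lim h th 0 = 2^-1 * (th `^ (- h) * G).
Proof.
move=> th0; rewrite /ou_cov_lim abspow0// !mulr0 expR0 oppr0 expprim0.
rewrite /expprim_lim.
have -> : th `^ (- (h + 1)) = th `^ (- h) * th^-1.
  rewrite opprD powRD; last by rewrite (gt_eqF th0) implybT.
  by rewrite powR_inv1// ltW.
by field; rewrite gt_eqF.
Qed.

Lemma ou_ac_rem (th : R) : 0 < th ->
  ou_cov_lim h th tau / ou_cov_lim h th 0
    - (1 - th `^ h * (p tau / G)) = ac_rem th.
Proof.
move=> th0; rewrite ou_cov_lim0// /ou_cov_lim /expprim_lim !expprim_scale//.
have -> : th `^ (- (h + 1)) = (th `^ h)^-1 * th^-1.
  rewrite opprD powRD; last by rewrite (gt_eqF th0) implybT.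
  by rewrite powR_inv1 ?powRN// ltW.
rewrite powRN /ac_rem mulrN mulNr ![th * tau]mulrC.
have thh0 : th `^ h != 0 by rewrite gt_eqF// powR_gt0.
rewrite expRN; field.
by rewrite G0 thh0 (gt_eqF th0) gt_eqF ?expR_gt0.
Qed.

Lemma ou_cov_lim0_gt0 (th : R) : 0 < th -> 0 < ou_cov_lim h th 0.
Proof.
by move=> th0; rewrite ou_cov_lim0// !mulr_gt0 ?powR_gt0 ?Gamma_gt0.
Qed.

End Remainder.

(** * Expectation of time integrals of continuous processes *)

Section ContinuousProcess.
Context {R : realType} {d : measure_display} {T : measurableType d}.
Variable P : probability T R.
Local Notation mu := (@lebesgue_measure R).

Lemma grid_cvg (s : R) :
  (Num.floor (n.+1%:R * s))%:~R / n.+1%:R @[n --> \oo] --> s.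
Proof.
apply/cvgrPdist_le => e e0; near=> n.
have n0 : 0 < n.+1%:R :> R by rewrite ltr0n.
have /andP[lo up] := Num.Theory.floor_itv (n.+1%:R * s).
have -> : s - (Num.floor (n.+1%:R * s))%:~R / n.+1%:R
    = (n.+1%:R * s - (Num.floor (n.+1%:R * s))%:~R) / n.+1%:R.
  by field; rewrite gt_eqF.
rewrite ger0_norm; last by rewrite divr_ge0 ?subr_ge0// ltW.
apply: (@le_trans _ _ n.+1%:R^-1).
  rewrite ler_piMl ?invr_ge0 ?(ltW n0)// lerBlDr ltW//.
  by move: up; rewrite intrD addrC.
apply: ltW; near: n; exact: (near_infty_natSinv_lt (PosNum e0)).
Unshelve. all: by end_near. Qed.

(** A process with continuous paths is the pointwise limit of the processes
    frozen on the grid of mesh 1 / (n + 1), which are measurable as countable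
    gluings of products. *)
Lemma measurable_continuous_process (F : R -> T -> R) :
  (forall w, continuous (F ^~ w)) -> (forall s, measurable_fun setT (F s)) ->
  measurable_fun setT (fun z : T * R => F z.2 z.1).
Proof.
move=> cF mF.
pose D n (s : R) : R := (Num.floor (n.+1%:R * s))%:~R / n.+1%:R.
apply: (@measurable_fun_cvg _ _ _ _ (fun n z => F (D n z.2) z.1)).
  move=> n _ B mB; rewrite setTI.
  rewrite (_ : _ @^-1` _ = \bigcup_(k in [set: int])
      ((F (k%:~R / n.+1%:R) @^-1` B) `*`
       [set s | Num.floor (n.+1%:R * s) = k])); last first.
    apply/seteqP; split => [[w s] /= BF|[w s] [k _] [] /= + kE].
      by exists (Num.floor (n.+1%:R * s)).
    by rewrite /D kE.
  apply: countable_bigcupT_measurable => // k.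
  apply: measurableX; first by rewrite -[X in measurable X]setTI; exact: mF.
  rewrite (_ : [set _ | _] =
    `[k%:~R / n.+1%:R, (k + 1)%:~R / n.+1%:R[%classic)//.
  apply/seteqP; split => s /=; rewrite in_itv/= ler_pdivrMr// ltr_pdivlMr//;
    rewrite ![s * _]mulrC.
    by move=> <-; exact: Num.Theory.floor_itv.
  by move=> ?; apply/eqP; rewrite Num.Theory.floor_eq.
move=> [w s] _ /=.
apply: (@cvg_comp _ _ _ (fun n => D n s) (F ^~ w) _ (nbhs s)).
  exact: grid_cvg.
exact: cF.
Qed.

(** The bound C turns into integrability on the product space, since [0, t] has
    finite length. *)
Lemma expectation_Rintegral (F : R -> T -> R) (e : R -> R) (C t : R) :
    (forall w, continuous (F ^~ w)) -> (forall s, measurable_fun setT (F s)) ->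
    0 <= t ->
    (forall s, 0 <= s <= t -> ('E_P[fun w => `|F s w|%R] <= C%:E)%E) ->
    (forall s, 0 <= s <= t -> ('E_P[F s] = (e s)%:E)%E) ->
  let I w := \int[mu]_(s in `[0, t]) F s w in
  I \in Lfun P 1 /\ ('E_P[I] = (\int[mu]_(s in `[0%R, t]) e s)%R%:E)%E.
Proof.
move=> cF mF t0 FC Fe I.
(* The indicator makes the time variable range over the whole line. *)
pose G (z : T * R) : \bar R := (F z.2 z.1 * \1_(`[0, t]%classic) z.2)%:E.
have mG : measurable_fun setT G.
  apply/measurable_EFinP; apply: measurable_funM.
    exact: measurable_continuous_process.
  by apply: (@measurableT_comp _ _ _ _ _ _ (\1_(`[0, t]%classic) : R -> R)).
have int_w s : (\int[P]_w G (w, s) = (e s * \1_(`[0, t]%classic) s)%:E)%E.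
  rewrite /G /= indicE; have [|] := boolP (s \in `[0, t]%classic).
    rewrite inE/= in_itv/= => /Fe; rewrite unlock => Fs.
    by rewrite mulr1 -Fs; apply: eq_integral => w _; rewrite mulr1.
  by move=> _; rewrite mulr0 integral0_eq// => w _; rewrite mulr0.
have int_s w : (\int[mu]_s G (w, s) = (\int[mu]_(s in `[0, t]) F s w)%:E)%E.
  rewrite /Rintegral fineK; last first.
    apply: integrable_fin_num => //.
    exact: (continuous_itv_integrable 0 t (cF w)).
  rewrite [RHS]integral_mkcond; apply: eq_integral => s _.
  by rewrite /G/= restrict_EFin/= patch_indic.
have iG : (P \x mu)%E.-integrable setT G.
  apply/integrable21ltyP => //.
  apply: (@le_lt_trans _ _ (\int[mu]_(s in `[0%R, t]) C%:E)%E); last first.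
    rewrite integral_cst//= lebesgue_measure_itv/=.
    by case: ifP; rewrite ?mule0 ?ltry// -EFinM ltry.
  rewrite [leRHS]integral_mkcond; apply: ge0_le_integral => //.
  - by move=> s _; exact: integral_ge0.
  - apply: (measurable_fun_fubini_tonelli_G (abse \o G)) => //.
      exact: measurableT_comp.
    by move=> z; exact: (abse_ge0 (G z)).
  - by apply: (measurable_restrictT _ _).1 => //; exact: measurable_cst.
  - move=> s _; rewrite epatch_indic/= indicE.
    have [|] := boolP (s \in `[0, t]%classic).
      rewrite inE/= in_itv/= mule1 => /FC; rewrite unlock; apply: le_trans.
      rewrite le_eqVlt; apply/predU1P; left; apply: eq_integral => w _.
      by rewrite mulr1.
    by move=> _; rewrite mule0 integral0_eq// => w _; rewrite mulr0 normr0.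
have IG : EFin \o I = fubini_F mu G.
  by apply/funext => w /=; rewrite -int_s.
have iI : P.-integrable setT (EFin \o I).
  by rewrite IG; exact: integrable_fubini_F.
split; first exact/Lfun1_integrable.
have EI : ('E_P[I] = \int[mu]_s (e s * \1_(`[0%R, t]%classic) s)%R%:E)%E.
  rewrite unlock; transitivity (\int[P]_w fubini_F mu G w)%E.
    by apply: eq_integral => w _; rewrite -IG.
  rewrite /fubini_F (@Fubini _ _ _ _ _ P mu G iG).
  by apply: eq_integral => s _; rewrite int_w.
rewrite Rintegral_mkcond /Rintegral patch_indic fineK//=.
by rewrite -EI expectation_fin_num//; exact/Lfun1_integrable.
Qed.

End ContinuousProcess.

(** * The L2 product of random variables *)

Section SquareIntegrable.
Context {R : realType} {d : measure_display} {T : measurableType d}.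
Variable P : probability T R.
Implicit Types (X Y Z : T -> R) (k : R).
Local Notation mu := (@lebesgue_measure R).

Definition sqint X : Prop :=
  measurable_fun setT X /\ P.-integrable setT (fun w => (X w ^+ 2)%:E).

Definition ip X Y : R := fine (\int[P]_w (X w * Y w)%:E)%E.

Lemma integrable_le (g : T -> \bar R) X : measurable_fun setT X ->
  P.-integrable setT g -> (forall w, (`|X w|%:E <= g w)%E) ->
  P.-integrable setT (fun w => (X w)%:E).
Proof.
move=> mX ig le_g; apply: (le_integrable _ _ _ ig) => //.
- exact/measurable_EFinP.
- move=> w _ /=; apply: (le_trans (le_g w)).
  exact: lee_abs.
Qed.

Lemma sqint_mul X Y : sqint X -> sqint Y ->
  P.-integrable setT (fun w => (X w * Y w)%:E).
Proof.
move=> [mX iX] [mY iY].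
apply: (integrable_le _ (integrableD _ iX iY)) => //.
  exact: measurable_funM.
move=> w /=; rewrite -EFinD lee_fin ler_norml.
by apply/andP; split; nra.
Qed.

Lemma sqint_cst k : sqint (fun=> k).
Proof. by split => //; exact: finite_measure_integrable_cst. Qed.

Lemma sqint_dom (g : T -> R) X : measurable_fun setT X ->
  P.-integrable setT (fun w => (g w)%:E) -> (forall w, X w ^+ 2 <= g w) ->
  sqint X.
Proof.
move=> mX ig le_g; split => //.
apply: (integrable_le _ ig); first exact: measurable_funX.
by move=> w; rewrite lee_fin ger0_norm ?sqr_ge0.
Qed.

Lemma sqintD X Y : sqint X -> sqint Y -> sqint (fun w => X w + Y w).
Proof.
move=> sX sY; have [mX iX] := sX; have [mY iY] := sY.
apply: (@sqint_dom (fun w => X w ^+ 2 + Y w ^+ 2 + (X w ^+ 2 + Y w ^+ 2))).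
- exact: measurable_funD.
- by apply: (integrableD _ (integrableD _ iX iY) (integrableD _ iX iY)).
- by move=> w; have := sqr_ge0 (X w - Y w); nra.
Qed.

Lemma sqintZ k X : sqint X -> sqint (fun w => k * X w).
Proof.
move=> [mX iX]; split; first exact: measurable_funM.
under eq_fun do rewrite exprMn EFinM.
exact: integrableZl.
Qed.

Lemma expectation_ip X Y : sqint X -> sqint Y ->
  ('E_P[fun w => (X w * Y w)%R] = (ip X Y)%:E)%E.
Proof.
move=> sX sY; rewrite unlock /ip fineK//.
exact: (integrable_fin_num _ (sqint_mul sX sY)).
Qed.

Lemma ipC X Y : ip X Y = ip Y X.
Proof. by congr fine; apply: eq_integral => w _; rewrite mulrC. Qed.

Lemma ipDl X Y Z : sqint X -> sqint Y -> sqint Z ->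
  ip (fun w => X w + Y w) Z = ip X Z + ip Y Z.
Proof.
move=> sX sY sZ; apply: EFin_inj.
rewrite EFinD -!expectation_ip//; last exact: sqintD.
rewrite -expectationD; last 2 first.
- exact/Lfun1_integrable/sqint_mul.
- exact/Lfun1_integrable/sqint_mul.
by congr expectation; apply/funext => w /=; rewrite mulrDl.
Qed.

Lemma ipZl k X Y : sqint X -> sqint Y -> ip (fun w => k * X w) Y = k * ip X Y.
Proof.
move=> sX sY; apply: EFin_inj.
rewrite EFinM -!expectation_ip//; last exact: sqintZ.
rewrite -expectationZl; last exact/Lfun1_integrable/sqint_mul.
by congr expectation; apply/funext => w /=; rewrite -mulrA mulrC.
Qed.

Lemma ipDr X Y Z : sqint X -> sqint Y -> sqint Z ->
  ip Z (fun w => X w + Y w) = ip Z X + ip Z Y.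
Proof. by move=> sX sY sZ; rewrite ipC ipDl// ![ip _ Z]ipC. Qed.

Lemma ipZr k X Y : sqint X -> sqint Y -> ip Y (fun w => k * X w) = k * ip Y X.
Proof. by move=> sX sY; rewrite ipC ipZl// ipC. Qed.

Lemma ip_ae X X' Y : measurable_fun setT X -> measurable_fun setT X' ->
  measurable_fun setT Y -> {ae P, forall w, X w = X' w} -> ip X Y = ip X' Y.
Proof.
move=> mX mX' mY XX'; congr fine; apply: ae_eq_integral => //.
- by apply/measurable_EFinP; exact: measurable_funM.
- by apply/measurable_EFinP; exact: measurable_funM.
- by apply: filterS XX' => w /= -> _.
Qed.

Lemma sqint_ae X X' : measurable_fun setT X' ->
  {ae P, forall w, X w = X' w} -> sqint X -> sqint X'.
Proof.
move=> mX' XX' [mX iX]; split => //.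
have mX'2 : measurable_fun setT (fun w => (X' w ^+ 2)%:E).
  by apply/measurable_EFinP; exact: measurable_funX.
apply/integrableP; split => //.
have /integrableP[mX2] := iX; apply: le_lt_trans; rewrite le_eqVlt.
apply/predU1P; left; apply: ae_eq_integral => //.
- exact: measurableT_comp.
- exact: measurableT_comp.
- by apply: filterS XX' => w /= -> _.
Qed.

Lemma expectation_abs_ip X Y : sqint X -> sqint Y ->
  ('E_P[fun w => `|X w * Y w|%R] <= (ip X X + ip Y Y)%:E)%E.
Proof.
move=> sX sY; rewrite EFinD -!expectation_ip// -expectationD; last 2 first.
- exact/Lfun1_integrable/sqint_mul.
- exact/Lfun1_integrable/sqint_mul.
have [mX _] := sX; have [mY _] := sY.
apply: expectation_le => //.
- by apply: measurableT_comp => //; exact: measurable_funM.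
- by apply: measurable_funD; exact: measurable_funM.
- by move=> w /=; rewrite addr_ge0// -expr2 sqr_ge0.
- apply: aeW => w /=; rewrite ler_norml.
  by apply/andP; split; nra.
Qed.

End SquareIntegrable.

(** * L2 products under time integrals *)

Section PathIntegrals.
Context {R : realType} {d : measure_display} {T : measurableType d}.
Variable P : probability T R.
Implicit Types (F U V : R -> T -> R).
Local Notation mu := (@lebesgue_measure R).

Lemma measurable_Rintegral_process F a b :
  (forall w, continuous (F ^~ w)) -> (forall s, measurable_fun setT (F s)) ->
  measurable_fun setT (fun w => \int[mu]_(s in `[a, b]) F s w).
Proof.
move=> cF mF.
pose G (z : T * R) : \bar R := (F z.2 z.1 * \1_(`[a, b]%classic) z.2)%:E.
have mG : measurable_fun setT G.
  apply/measurable_EFinP; apply: measurable_funM.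
    exact: measurable_continuous_process.
  by apply: (@measurableT_comp _ _ _ _ _ _ (\1_(`[a, b]%classic) : R -> R)).
rewrite (_ : (fun w => _) = fine \o
    (fun w => \int[mu]_s G^\+ (w, s) - \int[mu]_s G^\- (w, s))%E); last first.
  apply/funext => w /=; rewrite /Rintegral integral_mkcond; congr fine.
  rewrite [LHS]integralE; congr (_ - _)%E; apply: eq_integral => s _.
    by rewrite !funeposE restrict_EFin /G/= patch_indic.
  by rewrite !funenegE restrict_EFin /G/= patch_indic.
apply: measurableT_comp => //=.
apply: emeasurable_funB.
- by apply: measurable_fun_fubini_tonelli_F => //; exact: measurable_funepos.
- by apply: measurable_fun_fubini_tonelli_F => //; exact: measurable_funeneg.
Qed.

Lemma measurable_primitive_process F t :
  (forall w, continuous (F ^~ w)) -> (forall s, measurable_fun setT (F s)) ->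
  measurable_fun setT (fun w => primitive (F ^~ w) t).
Proof.
move=> cF mF.
by apply: measurable_funB; exact: measurable_Rintegral_process.
Qed.

(** Fubini for products.  The square integrability of the two processes,
    uniform on [0, t], provides the domination; the exponential weight is the
    integrating factor of the linear equations to which the lemma applies. *)
Lemma ip_Rintegral U V c C t :
    (forall w, continuous (U ^~ w)) -> (forall w, continuous (V ^~ w)) ->
    (forall s, measurable_fun setT (U s)) ->
    (forall s, measurable_fun setT (V s)) ->
    0 <= c -> 0 <= t ->
    (forall s, 0 <= s <= t -> sqint P (U s) /\ sqint P (V s)) ->
    (forall s, 0 <= s <= t -> ip P (U s) (U s) + ip P (V s) (V s) <= C) ->
  let I w := \int[mu]_(s in `[0, t]) (expR (c * s) * (U s w * V s w)) in
  P.-integrable setT (fun w => (I w)%:E) /\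
  ('E_P[I] =
    (\int[mu]_(s in `[0%R, t]) (expR (c * s) * ip P (U s) (V s)))%R%:E)%E.
Proof.
move=> cU cV mU mV c0 t0 sUV UVC I.
pose F s w := expR (c * s) * (U s w * V s w).
have [|||||] := @expectation_Rintegral R d T P F
    (fun s => expR (c * s) * ip P (U s) (V s)) (expR (c * t) * C) t.
- move=> w.
  exact: (cont_mul (@continuous_expRM R c) (cont_mul (cU w) (cV w))).
- by move=> s; apply: measurable_funM => //; exact: measurable_funM.
- by [].
- move=> s st; have [sU sV] := sUV s st; have /andP[s0 st'] := st.
  have [mUs _] := sU; have [mVs _] := sV.
  rewrite (_ : (fun w => _) =
    expR (c * s) \o* (fun w => `|U s w * V s w|)); last first.
    by apply/funext => w; rewrite /F normrM ger0_norm ?expR_ge0// mulrC.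
  rewrite expectationZl; last first.
    by apply: Lfun_norm; exact/Lfun1_integrable/sqint_mul.
  apply: (@le_trans _ _
    ((expR (c * s))%:E * (ip P (U s) (U s) + ip P (V s) (V s))%:E)%E).
    by rewrite lee_wpmul2l ?lee_fin ?expR_ge0//; exact: expectation_abs_ip.
  rewrite -EFinM lee_fin; apply: ler_pM; rewrite ?expR_ge0//.
  + by apply: addr_ge0; apply: fine_ge0; apply: integral_ge0 => w _;
      rewrite lee_fin -expr2 sqr_ge0.
  + by rewrite ler_expR ler_wpM2l.
  + exact: UVC.
- move=> s st; have [sU sV] := sUV s st.
  rewrite (_ : F s = expR (c * s) \o* (fun w => U s w * V s w)); last first.
    by apply/funext => w; rewrite /F /= mulrC.
  rewrite expectationZl; last exact/Lfun1_integrable/sqint_mul.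
  by rewrite expectation_ip// -EFinM.
by move=> /Lfun1_integrable iI EI; split.
Qed.

End PathIntegrals.

(** * Second moments of the filtered noise *)

(** Here Z is an arbitrary continuous process, and the hypotheses say that
    B = Z + th Y, with Y the integral of Z, has the second moments of
    sigma times a fractional Brownian motion.  The moments of Z are deduced. *)
Section OUProcess.
Context {R : realType} {d : measure_display} {T : measurableType d}.
Variable P : probability T R.
Variables (h th tau sigma : R) (Z : R -> T -> R).
Hypotheses (h0 : 0 < h) (th0 : 0 < th) (tau0 : 0 <= tau).
Hypotheses (cZ : forall w, continuous (Z ^~ w))
  (mZ : forall s, measurable_fun setT (Z s)).
Implicit Types (s t u : R) (w : T).
Local Notation mu := (@lebesgue_measure R).

Let Y t w := primitive (Z ^~ w) t.
Let B t w := Z t w + th * Y t w.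

Hypotheses (sB : forall s, 0 <= s -> sqint P (B s))
  (BB : forall s r, 0 <= s -> 0 <= r ->
     ip P (B s) (B r) = sigma ^+ 2 * fbm_cov h s r)
  (B1 : forall s, 0 <= s -> ip P (B s) (fun=> 1) = 0).

Let dY w t : is_derive t (1 : R) (Y ^~ w) (Z t w).
Proof. exact: is_derive_primitive. Qed.

Let cY w : continuous (Y ^~ w).
Proof. exact: derive_continuous (dY w). Qed.

Let cB w : continuous (B ^~ w).
Proof. exact: (cont_add (@cZ w) (cont_mul (@cont_cst R th) (@cY w))). Qed.

Let mY t : measurable_fun setT (Y t).
Proof. exact: measurable_primitive_process. Qed.

Let mB t : measurable_fun setT (B t).
Proof. by apply: measurable_funD => //; exact: measurable_funM. Qed.

(** Variation of constants for Y' = B - th Y. *)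
Lemma exp_primitive_path t w : 0 <= t ->
  \int[mu]_(s in `[0, t]) (expR (th * s) * B s w) = expR (th * t) * Y t w.
Proof.
move=> t0.
have cf := cont_mul (@continuous_expRM R th) (@cB w).
have dF s : is_derive s (1 : R) (fun s => expR (th * s) * Y s w)
    (expR (th * s) * B s w).
  apply: (is_derive_eq (d1_mul (d1_expRM th s) (dY w s))).
  by rewrite /B; ring.
rewrite (Rintegral_derive cf dF)//.
by rewrite /Y primitive0 mulr0 subr0.
Qed.

(** (Y^2)' = 2 B Y - 2 th Y^2 <= B^2 / (2 th), by completing the square.  The
    trivial weight exp(0 r) puts the bound in the shape of [ip_Rintegral]. *)
Lemma sqr_primitive_path_le s t w : 0 <= s -> s <= t ->
  Y s w ^+ 2 <= (2 * th)^-1 *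
    \int[mu]_(r in `[0, t]) (expR (0 * r) * (B r w * B r w)).
Proof.
move=> s0 st; have t0 := le_trans s0 st.
have cBB : continuous (fun r : R => expR (0 * r) * (B r w * B r w)).
  exact: (cont_mul (@continuous_expRM R 0) (cont_mul (@cB w) (@cB w))).
rewrite -(primitive_itv cBB t0).
set Q := primitive _.
have dQ r : is_derive r (1 : R) Q (expR (0 * r) * (B r w * B r w)).
  exact: is_derive_primitive.
have Qst : Q s <= Q t.
  apply: (derive_ge0_nondecreasing st dQ) => r _.
  by rewrite mulr_ge0 ?expR_ge0// -expr2 sqr_ge0.
have dF r : is_derive r (1 : R)
    (fun r => (2 * th)^-1 * Q r + - (Y r w * Y r w))
    ((2 * th)^-1 * (B r w - 2 * th * Y r w) ^+ 2).
  apply: (is_derive_eq (d1_add (d1_mul (d1_cst _ r) (dQ r))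
    (d1_opp (d1_mul (dY w r) (dY w r))))).
  by rewrite /= mul0r expR0 /B; field; rewrite gt_eqF.
have := derive_ge0_nondecreasing s0 dF.
rewrite /Q /Y !primitive0 -/Q !mulr0 subr0 -expr2 subr_ge0 => Ys.
apply: (@le_trans _ _ ((2 * th)^-1 * Q s)).
  by apply: Ys => r _; rewrite mulr_ge0 ?sqr_ge0// invr_ge0 mulr_ge0// ltW.
by rewrite ler_wpM2l// invr_ge0 mulr_ge0// ltW.
Qed.

Let ipBB_le s t : 0 <= s -> s <= t ->
  ip P (B s) (B s) <= sigma ^+ 2 * abspow h t.
Proof.
move=> s0 st; rewrite BB// /fbm_cov subrr abspow0// subr0.
rewrite ler_wpM2l ?sqr_ge0//; have := abspow_le h0 s0 st; lra.
Qed.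

Lemma integrable_sqr_path t : 0 <= t -> P.-integrable setT
  (fun w => (\int[mu]_(r in `[0, t]) (expR (0 * r) * (B r w * B r w)))%:E).
Proof.
move=> t0.
have [] // := @ip_Rintegral _ _ _ P B B 0
  (sigma ^+ 2 * abspow h t + sigma ^+ 2 * abspow h t) t
  cB cB mB mB (lexx 0) t0.
- by move=> s /andP[s0 _]; split; exact: sB.
- by move=> s /andP[s0 st]; rewrite lerD// ipBB_le.
Qed.

Let iB2 t : 0 <= t -> P.-integrable setT (fun w => ((2 * th)^-1 *
  \int[mu]_(r in `[0, t]) (expR (0 * r) * (B r w * B r w)))%:E).
Proof.
move=> t0; under eq_fun do rewrite EFinM.
by apply: integrableZl => //; exact: integrable_sqr_path.
Qed.

Lemma sqint_primitive t : 0 <= t -> sqint P (Y t).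
Proof.
move=> t0; apply: (sqint_dom (mY t) (iB2 t0)) => w.
exact: sqr_primitive_path_le.
Qed.

Lemma ip_primitive_bounded t : 0 <= t ->
  exists C, forall s, 0 <= s <= t -> ip P (Y s) (Y s) <= C.
Proof.
move=> t0; exists (fine (\int[P]_w ((2 * th)^-1 *
  \int[mu]_(r in `[0, t]) (expR (0 * r) * (B r w * B r w)))%:E)%E).
move=> s /andP[s0 st]; have sY := sqint_primitive s0.
apply: fine_le.
- exact: (integrable_fin_num _ (sqint_mul sY sY)).
- exact: (integrable_fin_num _ (iB2 t0)).
- apply: le_integral => //.
  + exact: (sqint_mul sY sY).
  + exact: iB2.
  + by move=> w _; rewrite lee_fin -expr2; exact: sqr_primitive_path_le.
Qed.

Lemma ip_primitive X u : sqint P X -> 0 <= u ->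
  expR (th * u) * ip P X (Y u)
  = \int[mu]_(s in `[0, u]) (expR (th * s) * ip P X (B s)).
Proof.
move=> sX u0; have [mX _] := sX.
have [||_] := @ip_Rintegral _ _ _ P (fun=> X) B th
   (ip P X X + sigma ^+ 2 * abspow h u) u
   (fun w => @cont_cst R (X w)) cB (fun=> mX) mB (ltW th0) u0.
- by move=> s /andP[s0 _]; split => //; exact: sB.
- by move=> s /andP[s0 su]; rewrite lerD2l ipBB_le.
rewrite (_ : (fun w => _) =
  expR (th * u) \o* (fun w => X w * Y u w)); last first.
  apply/funext => w /=.
  under eq_Rintegral do rewrite mulrCA.
  rewrite RintegralZl//; last first.
    apply: continuous_itv_integrable.
    exact: (cont_mul (@continuous_expRM R th) (@cB w)).
  by rewrite exp_primitive_path//; ring.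
have sY := sqint_primitive u0.
rewrite expectationZl; last exact/Lfun1_integrable/sqint_mul.
by rewrite expectation_ip// -EFinM => -[].
Qed.

Let ip_cst1_primitive u : 0 <= u -> ip P (fun=> 1) (Y u) = 0.
Proof.
move=> u0; apply: (mulfI (lt0r_neq0 (expR_gt0 (th * u)))).
rewrite (ip_primitive (sqint_cst P 1) u0) mulr0.
rewrite (@eq_Rintegral _ _ _ mu _ (fun=> 0)).
  by rewrite Rintegral_cst ?mul0r.
by move=> s; rewrite inE/= in_itv/= => /andP[s0 _]; rewrite ipC B1 ?mulr0.
Qed.

Let ip_B_primitive t u : 0 <= t -> 0 <= u ->
  ip P (B t) (Y u) = sigma ^+ 2 * fbm_filter_cov h th t u.
Proof.
move=> t0 u0; apply: (mulfI (lt0r_neq0 (expR_gt0 (th * u)))).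
rewrite (ip_primitive (sB t0) u0) [RHS]mulrCA -fbm_filter_covE//.
rewrite -RintegralZl//; last first.
  apply: continuous_itv_integrable.
  exact: (cont_mul (@continuous_expRM R th) (@continuous_fbm_cov R h h0 t)).
apply: eq_Rintegral => s; rewrite inE/= in_itv/= => /andP[s0 _].
by rewrite BB//; ring.
Qed.

(** The shifts a and b serve the two terms of the product rule at once. *)
Let ip_B_shifted_primitive (a b : R) t : 0 <= a -> 0 <= b -> 0 <= t ->
  let I w := \int[mu]_(s in `[0, t])
    (expR (2 * th * s) * (B (s + a) w * Y (s + b) w)) in
  P.-integrable setT (fun w => (I w)%:E) /\
  ('E_P[I] = (\int[mu]_(s in `[0%R, t]) (expR (2 * th * s) *
     (sigma ^+ 2 * fbm_filter_cov h th (s + a) (s + b))))%R%:E)%E.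
Proof.
move=> a0 b0 t0.
have [|C YC] := @ip_primitive_bounded (t + b); first exact: addr_ge0.
have shift (c : R) : continuous (fun s : R => s + c).
  exact: (cont_add (@cont_id R) (@cont_cst R c)).
have [||||iI EI] := @ip_Rintegral _ _ _ P
   (fun s => B (s + a)) (fun s => Y (s + b)) (2 * th)
   (sigma ^+ 2 * abspow h (t + a) + C) t
   (fun w => cont_comp (@cB w) (shift a))
   (fun w => cont_comp (@cY w) (shift b))
   (fun s => mB (s + a)) (fun s => mY (s + b)).
- by rewrite mulr_ge0// ltW.
- by [].
- move=> s /andP[s0 _].
  by split; [apply: sB|apply: sqint_primitive]; exact: addr_ge0.
- move=> s /andP[s0 st]; apply: lerD.
    by rewrite ipBB_le ?lerD2r// addr_ge0.
  by rewrite YC// addr_ge0//= lerD2r.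
split=> //; rewrite EI; congr (_%:E); apply: eq_Rintegral => s.
rewrite inE/= in_itv/= => /andP[s0 _].
by rewrite ip_B_primitive// addr_ge0.
Qed.

Let ip_primitive_primitive t : 0 <= t ->
  ip P (Y t) (Y (t + tau)) = sigma ^+ 2 * filter_cov h th tau t.
Proof.
move=> t0; apply: (mulfI (lt0r_neq0 (expR_gt0 (2 * th * t)))).
have [iI1 E1] := ip_B_shifted_primitive (lexx 0) tau0 t0.
have [iI2 E2] := ip_B_shifted_primitive tau0 (lexx 0) t0.
have sY := sqint_primitive t0; have sYu := sqint_primitive (addr_ge0 t0 tau0).
apply: EFin_inj; rewrite EFinM -expectation_ip// -expectationZl; last first.
  exact/Lfun1_integrable/sqint_mul.
have shift (c : R) : continuous (fun s : R => s + c).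
  exact: (cont_add (@cont_id R) (@cont_cst R c)).
have cI a b w : continuous (fun s : R =>
    expR (2 * th * s) * (B (s + a) w * Y (s + b) w)).
  exact: (cont_mul (@continuous_expRM R (2 * th))
    (cont_mul (cont_comp (@cB w) (shift a)) (cont_comp (@cY w) (shift b)))).
(* The product rule for exp(2 th t) Y_t Y_{t+tau}, which vanishes at t = 0. *)
have path w : expR (2 * th * t) * (Y t w * Y (t + tau) w) =
    \int[mu]_(s in `[0, t])
      (expR (2 * th * s) * (B (s + 0) w * Y (s + tau) w))
    + \int[mu]_(s in `[0, t])
      (expR (2 * th * s) * (B (s + tau) w * Y (s + 0) w)).
  rewrite -RintegralD//; last 2 first.
  - exact: (continuous_itv_integrable 0 t (@cI 0 tau w)).
  - exact: (continuous_itv_integrable 0 t (@cI tau 0 w)).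
  have dF (s : R) : is_derive s (1 : R)
      (fun s => expR (2 * th * s) * (Y s w * Y (s + tau) w))
      (expR (2 * th * s) * (B (s + 0) w * Y (s + tau) w)
       + expR (2 * th * s) * (B (s + tau) w * Y (s + 0) w)).
    have dshift := d1_comp (dY w) (d1_add (d1_id s) (d1_cst tau s)).
    apply: (is_derive_eq
      (d1_mul (d1_expRM (2 * th) s) (d1_mul (dY w s) dshift))).
    by rewrite /B !addr0; ring.
  rewrite (Rintegral_derive (cont_add (@cI 0 tau w) (@cI tau 0 w)) dF)//.
  by rewrite [X in X * Y (0 + tau) w]primitive0 mul0r mulr0 subr0.
pose I1 w := \int[mu]_(s in `[0, t])
  (expR (2 * th * s) * (B (s + 0) w * Y (s + tau) w)).
pose I2 w := \int[mu]_(s in `[0, t])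
  (expR (2 * th * s) * (B (s + tau) w * Y (s + 0) w)).
have L1 : I1 \in Lfun P 1 by apply: (Lfun1_integrable P I1).2; exact: iI1.
have L2 : I2 \in Lfun P 1 by apply: (Lfun1_integrable P I2).2; exact: iI2.
rewrite (_ : _ \o* _ = I1 \+ I2); last first.
  by apply/funext => w /=; rewrite mulrC path.
rewrite (expectationD L1 L2) [X in (X + _)%E]E1 [X in (_ + X)%E]E2 -EFinD.
congr (_%:E).
pose q a b s := expR (2 * th * s) * fbm_filter_cov h th (s + a) (s + b).
have cq a b : continuous (q a b).
  exact: (cont_mul (@continuous_expRM R (2 * th))
    (@continuous_fbm_filter_cov R h th h0 _ _ (shift a) (shift b))).
have Zq a b : \int[mu]_(s in `[0, t]) (expR (2 * th * s) *
    (sigma ^+ 2 * fbm_filter_cov h th (s + a) (s + b)))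
    = sigma ^+ 2 * \int[mu]_(s in `[0, t]) q a b s.
  rewrite -(RintegralZl (mu := mu) (D := `[0, t]%classic))//; last first.
    exact: (continuous_itv_integrable 0 t (@cq a b)).
  by apply: eq_Rintegral => s _; rewrite /q; ring.
rewrite !Zq -mulrDr -RintegralD//; last 2 first.
- exact: (continuous_itv_integrable 0 t (@cq 0 tau)).
- exact: (continuous_itv_integrable 0 t (@cq tau 0)).
rewrite [RHS]mulrCA; congr (_ * _).
apply: etrans (_ : _ = \int[mu]_(s in `[0, t]) (expR (2 * th * s) *
     (fbm_filter_cov h th s (s + tau)
      + fbm_filter_cov h th (s + tau) s))) _; last first.
  exact: filter_covE.
by apply: eq_Rintegral => s _; rewrite /q !addr0; ring.
Qed.

Lemma ou_expectation t : 0 <= t -> ip P (Z t) (fun=> 1) = 0.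
Proof.
move=> t0.
have sY := sqint_primitive t0.
rewrite (_ : Z t = fun w => B t w + - th * Y t w); last first.
  by apply/funext => w; rewrite /B; ring.
have s1 : sqint P (fun=> 1 : R) by exact: sqint_cst.
rewrite (ipDl (sB t0) (sqintZ _ sY) s1) (ipZl _ sY s1).
by rewrite B1// ipC ip_cst1_primitive// mulr0 addr0.
Qed.

Lemma sqint_ou t : 0 <= t -> sqint P (Z t).
Proof.
move=> t0; rewrite (_ : Z t = fun w => B t w + - th * Y t w); last first.
  by apply/funext => w; rewrite /B; ring.
by apply: sqintD; [exact: sB|apply: sqintZ; exact: sqint_primitive].
Qed.

Lemma ou_covariance t : 0 <= t ->
  ip P (Z t) (Z (t + tau)) = sigma ^+ 2 * ou_cov h th tau t.
Proof.
move=> t0; have u0 := addr_ge0 t0 tau0; set u := t + tau in u0 *.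
have sYt := sqint_primitive t0; have sYu := sqint_primitive u0.
have sBt := sB t0; have sBu := sB u0.
have sthYt := sqintZ (- th) sYt; have sthYu := sqintZ (- th) sYu.
have ZE s : Z s = fun w => B s w + - th * Y s w.
  by apply/funext => w; rewrite /B; ring.
have sZu : sqint P (fun w => B u w + - th * Y u w) by exact: sqintD.
rewrite (ZE t) (ZE u) (ipDl sBt sthYt sZu) (ipZl _ sYt sZu).
rewrite (ipDr sBu sthYu sBt) (ipDr sBu sthYu sYt).
rewrite (ipZr _ sYu sBt) (ipZr _ sYu sYt) (ipC P (Y t) (B u)).
rewrite (BB t0 u0) (ip_B_primitive t0 u0) (ip_B_primitive u0 t0).
rewrite (ip_primitive_primitive t0) /ou_cov -/u.
by ring.
Qed.

End OUProcess.

(** * Reduction of the equation to the filtered noise *)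

Lemma continuous_comp_norm {R : realType} (f : R -> R) :
  {within `[0, +oo[, continuous f} -> continuous (fun t : R => f `|t|).
Proof.
move=> /continuous_within_itvcyP[cf f0] t; have [->|t0] := eqVneq t 0.
  apply/cvgrPdist_lt => e e0; rewrite normr0.
  move/cvgrPdist_lt : f0 => /(_ e e0) [r /= r0 fr].
  apply/nbhs_normP; exists r => // s /=; rewrite sub0r normrN => sr.
  have [->|s0] := eqVneq s 0; first by rewrite normr0 subrr normr0.
  by apply: fr; rewrite /= ?normr_gt0// sub0r normrN normr_id.
apply: (@cvg_comp _ _ _ Num.norm f _ (nbhs (`|t| : R))).
  exact: norm_continuous.
by apply: cf; rewrite in_itv/= andbT normr_gt0.
Qed.

Section FBm.
Context {R : realType} {d : measure_display} {T : measurableType d}.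
Variable P : probability T R.
Variables (H : R) (W : R -> {RV P >-> R}).
Hypothesis W_fBm : is_fBm H W.

Let h : R := 2 * H.

Lemma fbm_sqint s : 0 <= s -> sqint P (W s).
Proof.
move=> s0; have mW : measurable_fun setT (W s) by exact: measurable_funP.
split => //; apply/integrableP; split.
  by apply/measurable_EFinP; exact: measurable_funX.
have [_ _ /(_ s s s0 s0)] := W_fBm; rewrite unlock => EW.
apply: le_lt_trans (ltry (2^-1 * (s `^ h + s `^ h - `|s - s| `^ h))).
rewrite -EW le_eqVlt; apply/predU1P; left; apply: eq_integral => w _.
by rewrite gee0_abs ?lee_fin ?sqr_ge0// expr2.
Qed.

Lemma fbm_ip s r : 0 <= s -> 0 <= r -> ip P (W s) (W r) = fbm_cov h s r.
Proof.
move=> s0 r0; have [_ _ /(_ s r s0 r0)] := W_fBm; rewrite unlock => EW.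
by rewrite /ip EW/= /fbm_cov /abspow (ger0_norm s0) (ger0_norm r0).
Qed.

Lemma fbm_ip1 s : 0 <= s -> ip P (W s) (fun=> 1) = 0.
Proof.
move=> s0; have [_ /(_ s s0) + _] := W_fBm; rewrite unlock => EW.
by rewrite /ip; under eq_integral do rewrite mulr1; rewrite EW.
Qed.

End FBm.

Section Solution.
Context {R : realType} {d : measure_display} {T : measurableType d}.
Variable P : probability T R.
Variables (H th tau sigma x0 : R) (W x : R -> {RV P >-> R}).
Hypotheses (H0 : 0 < H) (th0 : 0 < th) (tau0 : 0 <= tau).
Hypotheses (W_fBm : is_fBm H W) (x_sol : is_solution (- th) sigma x0 W x).
Local Notation mu := (@lebesgue_measure R).

(** The equation holds up to null sets depending on t, and W may have irregular
    paths.  So sigma W is replaced by the process B read off from x through the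
    equation: it has continuous paths and equals sigma W almost surely at each
    time, hence has the same second moments. *)
Lemma solution_autocov (t : R) : 0 <= t ->
  autocov x tau t = (sigma ^+ 2 * ou_cov (2 * H) th tau t)%:E.
Proof.
move=> t0; have [[N [mN PN Ncont]] eqn] := x_sol.
have h0 : 0 < 2 * H by rewrite mulr_gt0.
(* Z is the centred solution, set to 0 on a null set N carrying the
   discontinuous paths, and extended evenly in time so as to be continuous on
   the whole line. *)
pose mean (t : R) := x0 * expR (- th * `|t|).
pose Z (t : R) (w : T) := \1_(~` N) w * (x `|t| w - mean t).
have mx t' : measurable_fun setT (x t') by exact: measurable_funP.
have mZ t' : measurable_fun setT (Z t').
  apply: measurable_funM; first exact: measurable_indic (measurableC mN).
  exact: measurable_funB.
have cmean : continuous mean.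
  exact: (cont_mul (@cont_cst R x0)
    (cont_comp (@continuous_expRM R (- th)) (@norm_continuous R R))).
have cZ w : continuous (Z ^~ w).
  have [wN|wN] := pselect (N w).
    rewrite (_ : Z ^~ w = fun=> 0); first exact: cont_cst.
    by apply/funext => s; rewrite /Z indicE memNset ?mul0r// => /(_ wN).
  have cx : {within `[0, +oo[, continuous (fun t => x t w)}.
    by apply: contrapT => nc; apply: wN; apply: Ncont.
  exact: (cont_mul (@cont_cst R _)
    (cont_add (continuous_comp_norm cx) (cont_opp cmean))).
pose Y t w := primitive (Z ^~ w) t.
pose B t w := Z t w + th * Y t w.
have Zx s w : 0 <= s -> ~ N w -> x s w = Z s w + mean s.
  by move=> s0 wN; rewrite /Z indicE mem_set// mul1r ger0_norm// subrK.
have BW s : 0 <= s -> {ae P, forall w, sigma * W s w = B s w}.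
  move=> s0; have aeN : {ae P, forall w, ~ N w}.
    by exists N; split => // w /= /contrapT.
  apply: filterS2 aeN (eqn s s0) => w wN xE.
  have intx : \int[mu]_(r in `[0, s]) x r w
      = Y s w + x0 / th * (1 - expR (- th * s)).
    rewrite (@eq_Rintegral _ _ _ mu _
      (fun r => Z r w + x0 * expR (- th * r))); last first.
      move=> r; rewrite inE/= in_itv/= => /andP[r0 _].
      by rewrite (Zx _ _ r0 wN) /mean ger0_norm.
    have cf : continuous (fun r : R => Z r w + x0 * expR (- th * r)).
      exact: (cont_add (@cZ w)
        (cont_mul (@cont_cst R x0) (@continuous_expRM R (- th)))).
    have dF (r : R) : is_derive r (1 : R)
        (fun r => Y r w + - (x0 / th) * expR (- th * r))
        (Z r w + x0 * expR (- th * r)).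
      apply: (is_derive_eq (d1_add (is_derive_primitive r (@cZ w))
        (d1_mul (d1_cst _ r) (d1_expRM (- th) r)))).
      by field; rewrite gt_eqF.
    rewrite (Rintegral_derive cf dF)// /Y primitive0 mulr0 expR0.
    by ring.
  move: xE; rewrite intx /B (Zx _ _ s0 wN) /mean (ger0_norm s0) => xE.
  have -> : sigma * W s w = Z s w + x0 * expR (- th * s) - x0
     + th * (Y s w + x0 / th * (1 - expR (- th * s))).
    by rewrite xE; ring.
  by field; rewrite gt_eqF.
have mY s : measurable_fun setT (Y s).
  exact: measurable_primitive_process.
have mB s : measurable_fun setT (B s).
  by apply: measurable_funD => //; exact: measurable_funM.
have mW s : measurable_fun setT (fun w => sigma * W s w).
  exact: measurable_funM.
have sW s : 0 <= s -> sqint P (W s) by exact: fbm_sqint W_fBm _.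
have sB s : 0 <= s -> sqint P (B s).
  by move=> s0; apply: (sqint_ae (mB s) (BW s s0)); exact/sqintZ/sW.
have BB s r : 0 <= s -> 0 <= r ->
    ip P (B s) (B r) = sigma ^+ 2 * fbm_cov (2 * H) s r.
  move=> s0 r0.
  rewrite -(ip_ae (mW s) (mB s) (mB r) (BW s s0)) ipC.
  rewrite -(ip_ae (mW r) (mB r) (mW s) (BW r r0)).
  have sWs := sW s s0; have sWr := sW r r0.
  rewrite (ipZl _ sWr (sqintZ _ sWs)) (ipZr _ sWs sWr) (ipC P (W r)).
  by rewrite (fbm_ip W_fBm s0 r0); ring.
have B1 s : 0 <= s -> ip P (B s) (fun=> 1) = 0.
  move=> s0; rewrite -(ip_ae (mW s) (mB s) (measurable_cst _) (BW s s0)).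
  rewrite ipZl//; [|exact: sW|exact: sqint_cst].
  by rewrite (fbm_ip1 W_fBm s0) mulr0.
have u0 := addr_ge0 t0 tau0; set u := t + tau in u0 *.
have EZ s : 0 <= s -> ip P (Z s) (fun=> 1) = 0.
  exact: (ou_expectation h0 th0 cZ mZ sB BB B1).
have sZ s : 0 <= s -> sqint P (Z s) by exact: (sqint_ou h0 th0 cZ mZ sB BB).
have covZ : ip P (Z t) (Z u) = sigma ^+ 2 * ou_cov (2 * H) th tau t.
  exact: (ou_covariance h0 th0 tau0 cZ mZ sB BB).
pose one : T -> R := fun=> 1.
have s1 : sqint P one by exact: sqint_cst.
have ip11 : ip P one one = 1.
  by apply: EFin_inj; rewrite -expectation_ip// -(expectation_cst P 1)
    /one; under eq_fun do rewrite mulr1.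
pose X s w := Z s w + mean s * one w.
have sX s : 0 <= s -> sqint P (X s).
  by move=> s0; apply: sqintD; [exact: sZ|exact: sqintZ].
have Xx s : 0 <= s -> {ae P, forall w, X s w = x s w}.
  move=> s0; exists N; split => // w /= wE; apply: contrapT => wN; apply: wE.
  by rewrite /X /one mulr1 (Zx _ _ s0 wN).
have mX s : 0 <= s -> measurable_fun setT (X s) by move=> /sX[].
have sx s : 0 <= s -> sqint P (x s).
  by move=> s0; exact: sqint_ae (mx s) (Xx s s0) (sX s s0).
have Ex s : 0 <= s -> ('E_P[x s] = (mean s)%:E)%E.
  move=> s0.
  have -> : (x s : T -> R) = (fun w => x s w * one w).
    by apply/funext => w; rewrite mulr1.
  rewrite expectation_ip//; last exact: sx.
  rewrite -(ip_ae (mX s s0) (mx s) (measurable_cst _) (Xx s s0)).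
  have sZs := sZ s s0; have sms := sqintZ (mean s) s1.
  by rewrite (ipDl sZs sms s1) (ipZl _ s1 s1) ip11 (EZ s s0) add0r mulr1.
rewrite /autocov -/u expectation_ip; [|exact: sx|exact: sx].
rewrite !Ex// -EFinM -EFinB; congr (_%:E).
rewrite -(ip_ae (mX t t0) (mx t) (mx u) (Xx t t0)) ipC.
rewrite -(ip_ae (mX u u0) (mx u) (mX t t0) (Xx u u0)) ipC.
have sZt := sZ t t0; have sZu := sZ u u0.
have smt := sqintZ (mean t) s1; have smu := sqintZ (mean u) s1.
rewrite (ipDl sZt smt (sX u u0)) (ipZl _ s1 (sX u u0)).
rewrite (ipDr sZu smu sZt) (ipDr sZu smu s1) (ipZr _ s1 sZt) (ipZr _ s1 s1).
rewrite ip11 (ipC P one) (EZ t t0) (EZ u u0) covZ.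
by ring.
Qed.

End Solution.

(** * Passage to the limits *)

Section Asymptotics.
Context {R : realType} {d : measure_display} {T : measurableType d}.
Variable P : probability T R.
Variables (H th sigma x0 : R) (W x : R -> {RV P >-> R}).
Hypotheses (H0 : 0 < H) (H1 : H < 1) (th0 : 0 < th) (sigma0 : 0 < sigma).
Hypotheses (W_fBm : is_fBm H W) (x_sol : is_solution (- th) sigma x0 W x).

Let h0 : 0 < 2 * H. Proof. by rewrite mulr_gt0. Qed.
Let h2 : 2 * H < 2. Proof. by rewrite gtr_pMr. Qed.

Lemma autocov_cvg (tau : R) : 0 <= tau ->
  autocov x tau t @[t --> +oo] --> (sigma ^+ 2 * ou_cov_lim (2 * H) th tau)%:E.
Proof.
move=> tau0.
have lim_ou : (sigma ^+ 2 * ou_cov (2 * H) th tau t)%:E @[t --> +oo]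
    --> (sigma ^+ 2 * ou_cov_lim (2 * H) th tau)%:E.
  apply: cvg_EFin; first exact: nearW.
  by apply: cvgM; [exact: cvg_cst|exact: ou_cov_cvg].
apply: cvg_trans lim_ou; apply: near_eq_cvg.
apply: filterS (nbhs_pinfty_ge (num_real (0 : R))) => t t0.
by rewrite (solution_autocov H0 th0 tau0 W_fBm x_sol t0).
Qed.

Lemma VinfE (tau : R) : 0 <= tau ->
  Vinf x tau = (sigma ^+ 2 * ou_cov_lim (2 * H) th tau)%:E.
Proof. by move=> tau0; apply/cvg_lim => //; exact: autocov_cvg. Qed.

Lemma solution_ACinf_defined (tau : R) : 0 <= tau -> ACinf_defined x tau.
Proof.
move=> tau0; rewrite /ACinf_defined !VinfE//; split.
- by split => //; apply/cvg_ex; eexists; exact: autocov_cvg.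
- by split => //; apply/cvg_ex; eexists; exact: autocov_cvg.
- by rewrite eqe mulf_neq0 ?gt_eqF ?exprn_gt0 ?ou_cov_lim0_gt0.
Qed.

Lemma solution_ACinf (tau : R) : 0 <= tau ->
  ACinf x tau - (1 - th `^ (2 * H) * (tau `^ (2 * H) / Gamma (2 * H + 1)))
  = ac_rem (2 * H) tau th.
Proof.
move=> tau0; rewrite -ou_ac_rem// /ACinf !VinfE//= /abspow ger0_norm//.
by congr (_ - _); field; rewrite !gt_eqF ?ou_cov_lim0_gt0.
Qed.

End Asymptotics.

(** The remainder is expanded at th = 0 from the right, which is where
    th = - A(lambda) arrives when lambda tends to its critical value. *)
Lemma drift_cvg (R : realType) (a : R) (A : R -> R) :
  {within `]-oo, a], continuous A} -> (forall q, q < a -> A q < 0) -> A a = 0 ->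
  - A q @[q --> a^'-] --> 0^'+.
Proof.
move=> /continuous_within_itvNycP[_ cA] An A0 S [e /= e0 Se].
move: cA; rewrite A0 => /cvgrPdist_lt /(_ e e0) cA.
apply: filterS2 cA (nbhs_left_lt a) => q Aq qa.
apply: Se; last by rewrite /= oppr_gt0 An.
by rewrite /= opprK add0r -normrN -sub0r.
Qed.

Theorem corollary3p3 (R : realType) (d : measure_display)
    (T : measurableType d) (P : probability T R)
    (lambdastar : R) (A : R -> R)
    (A_cont : {within `]-oo, lambdastar], continuous A})
    (A_neg : forall lambda, lambda < lambdastar -> A lambda < 0)
    (A_star : A lambdastar = 0)
    (H sigma tau x0 : R) (H_gt0 : 0 < H) (H_lt1 : H < 1)
    (sigma_gt0 : 0 < sigma) (tau_ge0 : 0 <= tau)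
    (W : R -> {RV P >-> R}) (W_fBm : is_fBm H W)
    (x : R -> R -> {RV P >-> R})
    (x_sol : forall lambda, lambda < lambdastar ->
      is_solution (A lambda) sigma x0 W (x lambda)) :
  (forall lambda, lambda < lambdastar -> ACinf_defined (x lambda) tau) /\
  bigO_left lambdastar
    (fun lambda => ACinf (x lambda) tau
       - (1 - `|A lambda| `^ (2 * H) * (tau `^ (2 * H) / Gamma (2 * H + 1))))
    (fun lambda => `|A lambda| ^+ 2).
Proof.
have th_gt0 q : q < lambdastar -> 0 < - A q by move=> /A_neg; rewrite oppr_gt0.
have sol q : q < lambdastar -> is_solution (- - A q) sigma x0 W (x q).
  by rewrite opprK; exact: x_sol.
split=> [q qlt|].
  exact: (solution_ACinf_defined H_gt0 H_lt1 (th_gt0 q qlt) sigma_gt0 W_fBm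
    (sol q qlt)).
exists `|tau ^+ 2 / 2|; first exact: normr_ge0.
apply: cvg_norm.
have h0 : 0 < 2 * H by rewrite mulr_gt0.
have h2 : 2 * H < 2 by rewrite gtr_pMr.
have lim_rem := cvg_comp _ _ (drift_cvg A_cont A_neg A_star)
  (@ac_rem_cvg R _ tau h0 h2).
apply: cvg_trans lim_rem; apply: near_eq_cvg.
apply: filterS (nbhs_left_lt lambdastar) => q qlt.
rewrite /= (ltr0_norm (A_neg q qlt)).
by rewrite (solution_ACinf H_gt0 H_lt1 (th_gt0 q qlt) sigma_gt0 W_fBm
  (sol q qlt)).
Qed.
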